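(* (a) $\mathrm C^{\mathrm s}(\aleph_2)$ (or $\hat{\mathrm C}^{\mathrm s}(\aleph_2)$) implies $\mathfrak b^h=\aleph_1$. (b) $\mathrm{HP}(\aleph_2)$ implies $\mathfrak{do}=\min\{\mathrm{non}(\mathcal M),\mathrm{cov}(\mathcal M)\}=\min\{\mathrm{non}(\mathcal N),\mathrm{cov}(\mathcal N)\}=\aleph_1$, where $\mathcal M$ and $\mathcal N$ are the ideals of meager sets and of null sets over $\mathbb R$, respectively.
   Context: In $\langle{}^\omega\omega,\le^*\rangle$ (eventual domination), let $\mathfrak S^h=\{|X|: X\subseteq{}^\omega\omega$ and for all $B\subseteq X$, $B$ is $\le^*$-bounded iff $|B|<|X|\}$ and $\mathfrak b^h=\sup\mathfrak S^h$. For an ideal $I$ over a set $X$, $\mathrm{non}(I)=\min\{|A|:A\in\mathcal P(X)\setminus I\}$ and $\mathrm{cov}(I)=\min\{|\mathcal A|:\mathcal A\subseteq I,\bigcup\mathcal A=X\}$. $\mathcal H(\aleph_1)$ is the set of hereditarily countable sets. A set $A\subseteq\mathcal H(\aleph_1)$ is definable if there are a formula $\varphi$ of the language of set theory and $a\in\mathcal H(\aleph_1)$ with $A=\{x\in\mathcal H(\aleph_1):\langle\mathcal H(\aleph_1),\in\rangle\models\varphi(x,a)\}$. $\mathfrak{do}=\sup\mathfrak{DO}$, where $\mathfrak{DO}$ is the set of all $\mathrm{cf}(\mathrm{otp}(\langle X,R\restriction X\rangle))$ with $X\subseteq{}^\omega\omega$, $R$ a definable binary relation, and $R\cap X^2$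 well-ordering $X$. For a set $X$, $((X))^n$ is the set of injective $n$-tuples of elements of $X$, $((X))^{<\omega}=\bigcup_{n<\omega}((X))^n$, and $((X_0,\dots,X_{n-1}))$ is the set of injective tuples in $X_0\times\cdots\times X_{n-1}$. $f''S$ is the image of $S$ under $f$; ${}^{\omega>}\omega$ is the set of finite sequences of natural numbers, $|t|$ is the length of $t$; an intersection of subsets of $\omega$ over an empty index set is $\omega$. $\mathrm{HP}(\kappa)$: for any $f:\kappa\to\mathcal P(\omega)$ and any definable $A\subseteq((\mathcal P(\omega)))^{<\omega}$, at least one of the following holds: (h0) there is a stationary $S\subseteq\kappa$ such that $((f''S))^{<\omega}\setminus\{\emptyset\}\subseteq A$; (h1) there are $k\in\omega\setminus\{0\}$ and stationary $S_0,\dots,S_{k-1}\subseteq\kappa$ such that $((f''S_0,\dots,f''S_{k-1}))\cap A=\emptyset$. $\mathrm C^{\mathrm s}(\kappa)$: for any matrix $\langle a_{\alpha,n}:\alpha\in\kappa,n\in\omega\rangle$ of subsets of $\omega$ and any $T\subseteq{}^{\omega>}\omega$, at least one of the following holds: (c0) there is a stationary $S\subseteq\kappa$ such that $\bigcap_{n<|t|}a_{\alpha_n,t(n)}\neq\emptyset$ for all $t\in T$ and $\langle\alpha_0,\dots,\alpha_{|t|-1}\rangle\in((S))^{|t|}$; (c1) there are $t\in T$ and stationary $S_0,\dots,S_{|t|-1}\subseteq\kappa$ such that $\bigcap_{n<|t|}a_{\alpha_n,t(n)}=\emptyset$ for all $\langle\alpha_0,\dots,\alpha_{|t|-1}\rangle\in((S_0,\dots,S_{|t|-1}))$.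 $\hat{\mathrm C}^{\mathrm s}(\kappa)$: for any such matrix and $T$, at least one of the following holds: (ĉ0) there is a stationary $S\subseteq\kappa$ such that $\bigcap_{n<|t|}a_{\alpha_n,t(n)}$ is finite for every $t\in T$ and $\langle\alpha_0,\dots,\alpha_{|t|-1}\rangle\in((S))^{|t|}$; (ĉ1) there are $t\in T$ and stationary $S_0,\dots,S_{|t|-1}\subseteq\kappa$ such that $\bigcap_{n<|t|}a_{\alpha_n,t(n)}$ is infinite for every $\langle\alpha_0,\dots,\alpha_{|t|-1}\rangle\in((S_0,\dots,S_{|t|-1}))$. *)

(* Defs.v *)
From HB Require Import structures.
From mathcomp Require Import all_boot all_order all_algebra.
From mathcomp Require Export all_classical all_reals all_analysis.
From mathcomp Require wochoice.
Export numFieldNormedType.Exports.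

Set Implicit Arguments.
Unset Strict Implicit.
Unset Printing Implicit Defensive.

Import Order.TTheory.

Local Open Scope classical_set_scope.
Local Open Scope card_scope.

(** * Cardinals *)

(* A cardinal is represented by any set of that cardinality. *)

Definition card_lt {T U : Type} (A : set T) (B : set U) : Prop :=
  A #<= B /\ ~ (B #<= A).

(* |B| is the least cardinal greater than |A|; it is enough to compare |B|
   with the cardinalities of the subsets of B. *)
Definition card_succ {T U : Type} (A : set T) (B : set U) : Prop :=
  card_lt A B /\ forall C : set U, C `<=` B -> card_lt A C -> B #<= C.

Definition is_aleph1 {T : Type} (A : set T) : Prop := card_succ [set: nat] A.

Definition is_aleph2 {T : Type} (A : set T) : Prop :=
  exists2 B : set T, is_aleph1 B & card_succ B A.

(* A belongs to F and |A| = min {|B| : B in F}. *)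
Definition card_min {T : Type} (F : set (set T)) (A : set T) : Prop :=
  F A /\ forall B, F B -> A #<= B.

(* |A| = sup {|X| : X in F}. *)
Definition card_sup {T U : Type} (F : set (set T)) (A : set U) : Prop :=
  (forall X, F X -> X #<= A) /\
  (forall (V : Type) (L : set V), (forall X, F X -> X #<= L) -> A #<= L).

(** * Stationary subsets of the ordinal omega_2 *)

(* K is (a copy of) the initial ordinal omega_2. *)
Definition is_omega2 (d : Order.disp_t) (K : orderType d) : Prop :=
  [/\ well_founded (fun x y : K => (x < y)%O),
      is_aleph2 [set: K] &
      forall x : K, card_lt [set y : K | (y < x)%O] [set: K]].

Definition unbounded (d : Order.disp_t) (K : orderType d) (C : set K) : Prop :=
  forall x : K, exists2 y, C y & (x <= y)%O.

Definition limit_point (d : Order.disp_t) (K : orderType d) (C : set K)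
    (x : K) : Prop :=
  (exists y : K, (y < x)%O) /\
  (forall y : K, (y < x)%O -> exists2 z, C z & (y < z < x)%O).

Definition club (d : Order.disp_t) (K : orderType d) (C : set K) : Prop :=
  unbounded C /\ forall x, limit_point C x -> C x.

Definition stationary (d : Order.disp_t) (K : orderType d) (E : set K) : Prop :=
  forall C : set K, club C -> E `&` C !=set0.

(** * Injective tuples *)

(* ((X))^{< omega} *)
Definition inj_tuples {T : eqType} (X : set T) : set (seq T) :=
  [set s | uniq s /\ forall x, x \in s -> X x].

(* ((X_0, ..., X_{k-1})), where Xs = [:: X_0; ...; X_{k-1}] *)
Definition inj_prod {T : eqType} (Xs : seq (set T)) : set (seq T) :=
  [set s | uniq s && all2 (fun x (X : set T) => x \in X) s Xs].

(** * Hereditarily countable sets and definability *)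

(* Aczel's sets: Sup f is the set of all f a, and set-theoretic equality is
   Veq rather than Leibniz equality. Every hereditarily countable set is of
   this form with A empty or A = nat, hence index types in Set are enough. *)
Inductive V : Type := Sup : forall A : Set, (A -> V) -> V.

Fixpoint Veq (x y : V) {struct x} : Prop :=
  match x, y with
  | Sup A f, Sup B g =>
      (forall a, exists b, Veq (f a) (g b)) /\
      (forall b, exists a, Veq (f a) (g b))
  end.

Definition Vin (x y : V) : Prop :=
  match y with Sup B g => exists b, Veq x (g b) end.

Inductive trans_closure (x : V) : V -> Prop :=
| tc_base y : Vin y x -> trans_closure x y
| tc_step y z : trans_closure x y -> Vin z y -> trans_closure x z.

(* H(aleph_1): the transitive closure is countable. *)
Definition hered_countable (x : V) : Prop :=
  exists g : nat -> V, forall y, trans_closure x y -> exists n, Veq y (g n).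

Definition Vempty : V := Sup (of_void V).

Definition Vpair (x y : V) : V := Sup (fun b : bool => if b then x else y).

(* Kuratowski pairs. *)
Definition Vopair (x y : V) : V := Vpair (Vpair x x) (Vpair x y).

Definition Vsucc (x : V) : V :=
  match x with
  | Sup A f => Sup (fun o : option A => if o is Some a then f a else x)
  end.

(* von Neumann numerals. *)
Fixpoint Vnat (n : nat) : V := if n is m.+1 then Vsucc (Vnat m) else Vempty.

Definition Vset (X : set nat) : V := Sup (fun n : {n | X n} => Vnat (sval n)).

Definition Vfun (f : nat -> nat) : V :=
  Sup (fun n : nat => Vopair (Vnat n) (Vnat (f n))).

(* Finite sequences are functions whose domain is a natural number. *)
Definition Vseq (s : seq V) : V :=
  Sup (fun i : {i : nat | (i < size s)%N} =>
    Vopair (Vnat (sval i)) (nth Vempty s (sval i))).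

(* Formulas of the language of set theory, with de Bruijn indices. *)
Inductive formula : Type :=
| FIn : nat -> nat -> formula
| FEq : nat -> nat -> formula
| FNot : formula -> formula
| FAnd : formula -> formula -> formula
| FEx : formula -> formula.

(* Satisfaction in <H(aleph_1), in>; e lists the values of the free variables,
   and a variable that has no value in e denotes the empty set. *)
Fixpoint sat (e : seq V) (phi : formula) : Prop :=
  match phi with
  | FIn i j => Vin (nth Vempty e i) (nth Vempty e j)
  | FEq i j => Veq (nth Vempty e i) (nth Vempty e j)
  | FNot p => ~ sat e p
  | FAnd p q => sat e p /\ sat e q
  | FEx p => exists2 x : V, hered_countable x & sat (x :: e) p
  end.

Definition definable (A : set V) : Prop :=
  exists (phi : formula) (a : V), hered_countable a /\
    A = [set x | hered_countable x /\ sat [:: x; a] phi].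

(** * The combinatorial principles *)

Definition HP (d : Order.disp_t) (K : orderType d) : Prop :=
  forall (f : K -> set nat) (A : set (seq (set nat))),
    A `<=` inj_tuples [set: set nat] ->
    definable [set x | exists2 s, A s & Veq x (Vseq (map Vset s))] ->
    (exists2 E : set K, stationary E & inj_tuples (f @` E) `\ [::] `<=` A) \/
    (exists Es : seq (set K),
      [/\ (0 < size Es)%N, forall E, E \in Es -> stationary E &
          inj_prod [seq f @` E | E <- Es] `&` A = set0]).

(* The intersection of the a_{s_n, t_n} for n < |t|, where |s| = |t|. *)
Definition matrix_cap {K : Type} (a : K -> nat -> set nat) (s : seq K)
    (t : seq nat) : set nat :=
  \big[setI/setT]_(p <- zip s t) a p.1 p.2.

Definition Cs (d : Order.disp_t) (K : orderType d) : Prop :=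
  forall (a : K -> nat -> set nat) (T : set (seq nat)),
    (exists2 E : set K, stationary E &
      forall t s, T t -> inj_tuples E s -> size s = size t ->
        matrix_cap a s t !=set0) \/
    (exists t, T t /\ exists Es : seq (set K),
      [/\ size Es = size t, forall E, E \in Es -> stationary E &
          forall s, inj_prod Es s -> matrix_cap a s t = set0]).

Definition Cs_hat (d : Order.disp_t) (K : orderType d) : Prop :=
  forall (a : K -> nat -> set nat) (T : set (seq nat)),
    (exists2 E : set K, stationary E &
      forall t s, T t -> inj_tuples E s -> size s = size t ->
        finite_set (matrix_cap a s t)) \/
    (exists t, T t /\ exists Es : seq (set K),
      [/\ size Es = size t, forall E, E \in Es -> stationary E &
          forall s, inj_prod Es s -> infinite_set (matrix_cap a s t)]).

(** * Cardinal invariants *)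

Definition ev_dom (f g : nat -> nat) : Prop :=
  \forall n \near \oo, (f n <= g n)%N.

Definition ev_bounded (B : set (nat -> nat)) : Prop :=
  exists g, forall f, B f -> ev_dom f g.

(* The sets X whose cardinalities form S^h. *)
Definition Sh : set (set (nat -> nat)) :=
  [set X | forall B, B `<=` X -> (ev_bounded B <-> card_lt B X)].

(* |A| = b^h *)
Definition is_bh {T : Type} (A : set T) : Prop := card_sup Sh A.

(* The restriction of R to functions, where R is a set of ordered pairs. *)
Definition rel_of (R : set V) : rel (nat -> nat) :=
  fun f g => `[< R (Vopair (Vfun f) (Vfun g)) >].

Definition cofinal {T : Type} (r : rel T) (X C : set T) : Prop :=
  C `<=` X /\ forall x, X x -> exists2 c, C c & r x c.

(* The sets C whose cardinalities form DO: cofinal subsets, of the least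
   possible cardinality, of some X well-ordered by a definable relation. *)
Definition DO : set (set (nat -> nat)) :=
  [set C | exists (X : set (nat -> nat)) (R : set V),
    [/\ definable R, forall z, R z -> exists x y, Veq z (Vopair x y),
        wochoice.wo_chain (rel_of R) (mem X) &
        card_min (cofinal (rel_of R) X) C]].

(* |A| = do *)
Definition is_do {T : Type} (A : set T) : Prop := card_sup DO A.

(* |A| = min {non(I), cov(I)} *)
Definition is_min_non_cov {T U : Type} (I : set (set T)) (A : set U) : Prop :=
  exists (N : set T) (F : set (set T)),
    [/\ card_min [set B | ~ I B] N,
        card_min [set G | G `<=` I /\ \bigcup_(B in G) B = setT] F &
        (N #<= F /\ A #= N) \/ (F #<= N /\ A #= F)].

Definition nowhere_dense {T : topologicalType} (A : set T) : Prop :=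
  interior (closure A) = set0.

Definition meager {T : topologicalType} : set (set T) :=
  [set A | exists2 F : nat -> set T,
    (forall n, nowhere_dense (F n)) & A = \bigcup_n F n].

Definition null (R : realType) : set (set R) :=
  [set A | (@lebesgue_measure R).-negligible A].

(* Main.v *)
Require Import Defs.
From mathcomp Require Import all_boot all_order all_algebra.
From mathcomp Require Import all_classical all_reals all_analysis.

Set Implicit Arguments.
Unset Strict Implicit.
Unset Printing Implicit Defensive.

Import Order.TTheory GRing.Theory Num.Theory.

Local Open Scope classical_set_scope.
Local Open Scope card_scope.

(** Each part refutes, under the combinatorial principle, the existence of a chain
   of length omega_2: a sequence of pairs (x_a, y_a), a < omega_2, and a
   relation E such that for a < b, E x_a y_b holds and E x_b y_a fails. A
   cardinal invariant above aleph_1 would produce such a chain by recursion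
   (omega2_chain): at each stage fewer than aleph_2 points have been chosen,
   one y lies above all of them, and the y chosen so far do not cover all the
   points.

   For b^h, E is eventual domination. If X is in S^h and |X| > aleph_1, then
   every subset of X of size aleph_1 is bounded, and one can restrict the
   choice of bounds so that no aleph_1 many of them dominate all of X
   (Sh_chain). Code x_a by the points of omega * omega on or below its graph,
   and y_a by the points strictly above its graph: the two codes of x_a and
   y_b have finite intersection exactly if x_a is eventually dominated by y_b.
   Both alternatives of C^s, and of its variant, then contain a pair of
   indices in the wrong order, because stationary sets are unbounded
   (Cs_no_chain).

   For the consequences of HP, each pair is coded by one subset of omega in
   such a way that E becomes a definable relation. Apply HP to the set of
   finite tuples that are strictly increasing for E: homogeneity would make
   two points increasing in both orders, while tuples taken in increasing
   order from k stationary sets belong to the set (HP_no_chain). This yields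
   at once that no definable relation well-orders a set of reals with
   cofinality above aleph_1. For the meager and the null ideal, the pairs
   consist of a real and a sequence of open sets (U_n), standing for the
   F_sigma set that is the complement of the intersection of the U_n, or for
   the G_delta set that is this intersection; such sets are cofinal in the two
   ideals, and x belongs to all U_n iff for each n some rational interval
   contains x and is included in U_n (min_non_cov_aleph1).

   The lower bounds hold outright. An unbounded family of least size gives a
   scale that is well-ordered by eventual domination (exists_scale), hence an
   uncountable member both of S^h and of DO; and the two ideals contain all
   countable sets and are closed under countable unions.

   Definability is handled semantically: each formula comes with a lemma that
   says what it means in environments of hereditarily countable sets, and
   countable tables serve as parameters in place of definitions of the
   codings. *)

(** * Cardinalities *)

(** Injections are mostly given by a relation whose witnesses have to be
   chosen. *)
Lemma card_le_rel {T U : Type} (A : set T) (B : set U) (G : T -> U -> Prop) :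
  (forall x, A x -> exists2 y, B y & G x y) ->
  (forall x x' y, A x -> A x' -> G x y -> G x' y -> x = x') ->
  A #<= B.
Proof.
move=> GB Ginj.
have [->|/set0P[x0 Ax0]] := eqVneq A set0; first exact: card_ge0.
have [y0 _ _] := GB _ Ax0.
have /choice[f fP] : forall x, exists y, A x -> B y /\ G x y.
  move=> x; have [Ax|nAx] := pselect (A x).
    by have [y By Gy] := GB _ Ax; exists y.
  by exists y0.
have : $|{injfun A >-> B}|.
  apply/injfunPex; exists f; first by move=> x /fP[].
  move=> x x' /set_mem Ax /set_mem Ax' e.
  by apply: (Ginj x x' (f x)) => //; [have [] := fP x Ax|rewrite e; have [] := fP x' Ax'].
by case=> h; exact: inj_card_le.
Qed.

Lemma card_le_inj {T U : Type} (A : set T) (B : set U) (f : T -> U) :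
  (forall x, A x -> B (f x)) ->
  (forall x x', A x -> A x' -> f x = f x' -> x = x') -> A #<= B.
Proof.
move=> fB finj; apply: (@card_le_rel _ _ _ _ (fun x y => f x = y)).
  by move=> x Ax; exists (f x) => //; exact: fB.
by move=> x x' y Ax Ax' <- /esym; exact: finj.
Qed.

Lemma card_le_injP {T U : Type} (A : set T) (B : set U) : A #<= B -> B !=set0 ->
  exists2 f : T -> U, (forall x, A x -> B (f x)) &
    forall x x', A x -> A x' -> f x = f x' -> x = x'.
Proof.
move=> AB [u0 _]; elim/Ppointed: U => U in B u0 AB *; first by case: (no u0).
have /pcard_leP/injfunPex[f fB finj] := AB; exists f => //.
by move=> x x' Ax Ax'; apply: finj; exact: mem_set.
Qed.

(** Zorn's lemma is applied to sets of choice functions on F that pairwise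
   differ everywhere: in a maximal such set G the values at some B in F
   exhaust B, and evaluation at any other member of F is injective on G. *)
Lemma card_min_exists {T : Type} (F : set (set T)) :
  F !=set0 -> exists A, card_min F A.
Proof.
move=> [B0 FB0].
pose P (G : set (set T -> T)) := (forall g B, G g -> F B -> B (g B)) /\
  (forall g h B, G g -> G h -> F B -> g B = h B -> g = h).
have [|G [[GB Ginj] Gmax]] := @Zorn_bigcup _ P.
  move=> C CP Ctot; split=> [g B [G CG Gg] FB|g h B [G CG Gg] [H CH Hh]].
    by have [GB _] := CP _ CG; exact: GB Gg FB.
  move=> FB gh; have [GH|HG] := Ctot _ _ CG CH.
    by have [_ inj] := CP _ CH; apply: (inj g h B) => //; exact: GH.
  by have [_ inj] := CP _ CG; apply: (inj g h B) => //; exact: HG.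
have [[B FB Bsurj]|noB] :=
    pselect (exists2 B, F B & forall x, B x -> exists2 g, G g & g B = x).
  exists B; split=> // C FC.
  apply: (@card_le_rel _ _ _ _ (fun x y => exists g, [/\ G g, g B = x & g C = y])).
    by move=> x /Bsurj[g Gg <-]; exists (g C); [exact: (GB g C Gg FC)|exists g].
  move=> x x' y _ _ [g [Gg <- gC]] [h [Gh <- hC]].
  by rewrite (Ginj g h C) // gC hC.
have new B : F B -> exists2 x, B x & forall g, G g -> g B <> x.
  move=> FB; apply: contrapT => nx; apply: noB; exists B => // x Bx.
  apply: contrapT => ng; apply: nx; exists x => // g Gg gx.
  by apply: ng; exists g.
have [x0 _ _] := new _ FB0.
have /choice[h hP] : forall B, exists x, F B -> B x /\ forall g, G g -> g B <> x.
  move=> B; have [FB|nFB] := pselect (F B); last by exists x0.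
  by have [x Bx xP] := new _ FB; exists x.
case: (Gmax (G `|` [set h])).
  split; first by left.
  move=> /(_ h (or_intror erefl)) Gh.
  by have [_ /(_ h Gh)] := hP _ FB0.
split=> [g B [Gg FB|-> FB]|g g' B [Gg|->] [Gg'|->] FB] //.
- exact: GB Gg FB.
- by have [] := hP _ FB.
- exact: Ginj Gg Gg' FB.
- by have [_ /(_ _ Gg)] := hP _ FB.
- by have [_ /(_ _ Gg')] := hP _ FB => + /esym.
Qed.

(** The least cardinality among the copies of A and B in the disjoint sum. *)
Lemma card_le_total {T U : Type} (A : set T) (B : set U) : A #<= B \/ B #<= A.
Proof.
have iA : (@inl T U) @` A #= A by apply: inj_card_eq => x y _ _ [].
have iB : (@inr T U) @` B #= B by apply: inj_card_eq => x y _ _ [].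
pose F : set (set (T + U)) := [set (@inl T U) @` A; (@inr T U) @` B].
have [|C [[->|->] Cmin]] := @card_min_exists _ F; first by exists (inl @` A); left.
  by left; rewrite -(card_le_eql iA) -(card_le_eqr iB); apply: Cmin; right.
by right; rewrite -(card_le_eql iB) -(card_le_eqr iA); apply: Cmin; left.
Qed.

Lemma card_leNgt {T U : Type} (A : set T) (B : set U) : ~ (A #<= B) -> B #<= A.
Proof. by move=> nAB; have [] := card_le_total A B. Qed.

Lemma card_ltNge {T U : Type} (A : set T) (B : set U) : card_lt A B <-> ~ (B #<= A).
Proof. by split=> [[]//|nBA]; split=> //; exact: card_leNgt. Qed.

Lemma card_lt_transl {T U W : Type} (A : set T) (B : set U) (C : set W) :
  A #<= B -> card_lt B C -> card_lt A C.
Proof.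
move=> AB /card_ltNge CB; apply/card_ltNge => CA; apply: CB.
exact: card_le_trans AB.
Qed.

Lemma card_lt_transr {T U W : Type} (A : set T) (B : set U) (C : set W) :
  card_lt A B -> B #<= C -> card_lt A C.
Proof.
move=> /card_ltNge BA BC; apply/card_ltNge => CA; apply: BA.
exact: card_le_trans CA.
Qed.

Lemma card_le_exists_subset {T U : Type} (A : set T) (B : set U) :
  A #<= B -> exists2 C, C `<=` B & C #= A.
Proof.
have [->|/set0P B0] := eqVneq B set0.
  by move=> /card_le0P ->; exists set0.
move=> /card_le_injP /(_ B0) [f fB finj]; exists (f @` A).
  by move=> _ [x Ax <-]; exact: fB.
by apply: inj_card_eq => x y /set_mem Ax /set_mem Ay; exact: finj.
Qed.

(** The definition of successors only compares B with its own subsets; sets of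
   other types are copied into B. *)
Lemma card_succ_le {T U W : Type} (A : set T) (B : set U) (C : set W) :
  card_succ A B -> ~ (C #<= A) -> B #<= C.
Proof.
move=> [_ Bmin] CA; have [//|CB] := card_le_total B C.
have [D DB DC] := card_le_exists_subset CB.
rewrite -(card_le_eqr DC); apply: Bmin => //.
by apply/card_ltNge; rewrite (card_le_eql DC).
Qed.

Lemma card_succ_lt {T U W : Type} (A : set T) (B : set U) (C : set W) :
  card_succ A B -> card_lt C B -> C #<= A.
Proof.
move=> AB /card_ltNge BC; apply: contrapT => CA; apply: BC.
exact: (card_succ_le AB).
Qed.

Lemma aleph1_leP {T U : Type} (A : set T) (X : set U) :
  is_aleph1 A -> ~ countable X -> A #<= X.
Proof. exact: card_succ_le. Qed.

Lemma aleph1_card_le {T U : Type} (A : set T) (B : set U) :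
  is_aleph1 A -> is_aleph1 B -> A #<= B.
Proof. by move=> hA [[_ hB] _]; apply: (aleph1_leP hA). Qed.

Lemma aleph1_infinite {T : Type} (A : set T) : is_aleph1 A -> infinite_set A.
Proof. by move=> [[+ _] _] => /infiniteP. Qed.

Lemma card_le_setX {T U : Type} (A B : set T) (A' B' : set U) :
  A #<= A' -> B #<= B' -> A `*` B #<= A' `*` B'.
Proof.
have [->|/set0P nA'] := eqVneq A' set0.
  by move=> /card_le0P -> _; rewrite set0X; exact: card_ge0.
have [->|/set0P nB'] := eqVneq B' set0.
  by move=> _ /card_le0P ->; rewrite setX0; exact: card_ge0.
move=> /card_le_injP /(_ nA')[f fA finj] /card_le_injP /(_ nB')[g gB ginj].
apply: (@card_le_inj _ _ _ _ (fun p => (f p.1, g p.2))).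
  by move=> [x y] [/= Ax By]; split; [exact: fA|exact: gB].
move=> [x y] [x' y'] /= [Ax By] [Ax' By'] [/= fx gy].
by rewrite (finj x x') // (ginj y y').
Qed.

(** Stated with |C * C| <= |C| as a hypothesis, since it is used to prove that
   this inequality holds for all infinite sets. *)
Lemma card_bigcup_le_square {I T U : Type} (S : set I) (F : I -> set T) (C : set U) :
  C `*` C #<= C -> S #<= C -> (forall i, S i -> F i #<= C) ->
  \bigcup_(i in S) F i #<= C.
Proof.
move=> CC SC FC; apply: card_le_trans CC.
have [C0|/set0P nC] := eqVneq C set0.
  suff -> : \bigcup_(i in S) F i = set0 by exact: card_ge0.
  apply/seteqP; split=> // x [i Si _].
  by move: SC; rewrite C0 => /card_le0P S0; rewrite S0 in Si.
have [j jC jinj] := card_le_injP SC nC.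
have /choice[f fP] : forall i, exists f : T -> U, S i ->
    (forall x, F i x -> C (f x)) /\
    forall x x', F i x -> F i x' -> f x = f x' -> x = x'.
  move=> i; have [Si|nSi] := pselect (S i).
    by have [f fC finj] := card_le_injP (FC i Si) nC; exists f.
  by have [c _] := nC; exists (fun=> c).
apply: (@card_le_rel _ _ _ _
    (fun x p => exists i, [/\ S i, F i x & p = (j i, f i x)])).
  move=> x [i Si Fx]; exists (j i, f i x); last by exists i.
  by split; [exact: jC|have [+ _] := fP i Si; apply].
move=> x x' _ _ _ [i [Si Fx ->]] [i' [Si' Fx' [ji fx]]].
have e := jinj _ _ Si Si' ji; subst i'.
by have [_] := fP i Si; apply.
Qed.

Lemma card_setU_le_square {T U : Type} (A B : set T) (C : set U) : infinite_set C ->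
  C `*` C #<= C -> A #<= C -> B #<= C -> A `|` B #<= C.
Proof.
move=> Cinf CC AC BC.
have -> : A `|` B = \bigcup_(b in [set: bool]) (if b then A else B).
  apply/seteqP; split=> x; first by case=> ?; [exists true|exists false].
  by case=> -[] _ ?; [left|right].
apply: card_bigcup_le_square => //; last by case.
by apply: card_le_trans (countableP _) _; exact/infiniteP.
Qed.

(** Zorn's lemma is applied to graphs of injections D x D -> D with D a subset
   of A.  If D is the domain of a maximal one and |D| < |A|, then A \ D has a
   subset E of size |D|, and as the new part of (D + E) x (D + E) also has
   size |D|, it can be injected into E. *)
Lemma card_square {T : Type} (A : set T) : infinite_set A -> A `*` A #<= A.
Proof.
move=> Ainf; have A0 : A !=set0 by exact: infinite_setN0.
have [e eA einj] := card_le_injP ((infiniteP A).1 Ainf) A0.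
pose D (G : set (T * T * T)) := [set x | exists y z, G (x, y, z)].
pose ok (G : set (T * T * T)) := [/\ D G `<=` A,
  forall x y, D G x -> D G y -> exists2 z, D G z & G (x, y, z),
  forall x y z, G (x, y, z) -> D G y /\ D G z &
  forall p q z, G (p, z) -> G (q, z) -> p = q].
pose G0 : set (T * T * T) :=
  [set p | exists m n, p = (e m, e n, e (pickle (m, n)))].
have DG0 n : D G0 (e n) by exists (e n), (e (pickle (n, n))), n, n.
have G0D x : D G0 x -> exists n, x = e n.
  by move=> [y [z [m [n [-> _ _]]]]]; exists m.
have okG0 : ok G0.
  split.
  - by move=> x /G0D[n ->]; exact: eA.
  - move=> _ _ /G0D[m ->] /G0D[n ->]; exists (e (pickle (m, n))); first exact: DG0.
    by exists m, n.
  - by move=> x y z [m [n [_ -> ->]]]; split; exact: DG0.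
  - move=> p q z [m [n [-> ->]]] [m' [n' [-> /einj]]].
    by move=> /(_ I I) /(pcan_inj pickleK)[-> ->].
pose P G := ok (G0 `|` G).
have [|G [okG Gmax]] := @Zorn_bigcup _ P.
  move=> F FP Ftot.
  have two p q : (G0 `|` \bigcup_(X in F) X) p -> (G0 `|` \bigcup_(X in F) X) q ->
      exists H, [/\ ok H, H `<=` G0 `|` \bigcup_(X in F) X, H p & H q].
    have FH H : F H -> G0 `|` H `<=` G0 `|` \bigcup_(X in F) X.
      by move=> FH; apply: setUS; exact: bigcup_sup.
    case=> [Gp|[H FH' Hp]] [Gq|[H' FH'' Hq]].
    - by exists G0; split=> //; exact: subsetUl.
    - by exists (G0 `|` H'); split; [exact: FP|exact: FH|left|right].
    - by exists (G0 `|` H); split; [exact: FP|exact: FH|right|left].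
    - have [HH|HH] := Ftot _ _ FH' FH''.
        by exists (G0 `|` H'); split; [exact: FP|exact: FH|right; exact: HH|right].
      by exists (G0 `|` H); split; [exact: FP|exact: FH|right|right; exact: HH].
  have DS H H' : H `<=` H' -> D H `<=` D H'.
    by move=> HH x [y [z Hx]]; exists y, z; exact: HH.
  split.
  - move=> x [y [z Gx]]; have [H [[HA _ _ _] _ Hx _]] := two _ _ Gx Gx.
    by apply: HA; exists y, z.
  - move=> x y [x1 [x2 Gx]] [y1 [y2 Gy]].
    have [H [[_ HD _ _] HG Hx Hy]] := two _ _ Gx Gy.
    have [||z Dz Hz] := HD x y; [by exists x1, x2|by exists y1, y2|].
    by exists z; [exact: (DS H)|exact: HG].
  - move=> x y z Gx; have [H [[_ _ HD _] HG Hx _]] := two _ _ Gx Gx.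
    by have [Dy Dz] := HD _ _ _ Hx; split; exact: (DS H).
  - move=> p q z Gp Gq; have [H [[_ _ _ inj] _ Hp Hq]] := two _ _ Gp Gq.
    exact: inj Hp Hq.
set G1 := G0 `|` G in okG; have [DA DX DG Ginj] := okG.
have DDD : D G1 `*` D G1 #<= D G1.
  apply: (@card_le_rel _ _ _ _ (fun p z => G1 (p, z))).
    by move=> [x y] [/= Dx Dy]; exact: DX.
  by move=> p q z _ _; exact: Ginj.
have D0 : D G1 (e 0%N) by exists (e 0%N), (e (pickle (0%N, 0%N))); left; exists 0%N, 0%N.
have Dinf : infinite_set (D G1).
  apply/infiniteP; apply: (@card_le_inj _ _ _ _ e) => // n _.
  by exists (e n), (e (pickle (n, n))); left; exists n, n.
have [AD|/card_leNgt DAD] := pselect (A `\` D G1 #<= D G1).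
  have AleD : A #<= D G1.
    apply: card_le_trans (card_setU_le_square Dinf DDD (card_lexx _) AD).
    apply: subset_card_le => x Ax.
    by have [Dx|nDx] := pselect (D G1 x); [left|right].
  apply: card_le_trans (card_le_setX AleD AleD) (card_le_trans DDD _).
  exact: subset_card_le.
have [E EAD ED] := card_le_exists_subset DAD.
have DUE : D G1 `|` E #<= D G1.
  by apply: card_setU_le_square => //; have /card_eqPle[] := ED.
have E0 : E !=set0.
  apply/set0P/eqP => E0; have : D G1 #<= E by have /card_eqPle[] := ED.
  by rewrite E0 => /card_le0P DG0'; rewrite DG0' in D0.
pose N := (D G1 `|` E) `*` (D G1 `|` E) `\` D G1 `*` D G1.
have /card_le_injP /(_ E0)[k kE kinj] : N #<= E.
  apply: card_le_trans (subset_card_le (@subIsetl _ _ _)) _.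
  rewrite (card_le_eqr ED).
  exact: card_le_trans (card_le_setX DUE DUE) DDD.
pose G2 := G1 `|` [set p | N p.1 /\ p.2 = k p.1].
have DG2 : D G2 = D G1 `|` E.
  apply/seteqP; split=> [x [y [z [Gx|[[/= [/=+ _] _ _]]]]]|x].
  - by left; exists y, z.
  - by [].
  - case=> [[y [z Gx]]|Ex]; first by exists y, z; left.
    exists (e 0%N), (k (x, e 0%N)); right; split=> //=; split=> /=.
      by split; [right|left].
    by move=> [/= Dx _]; have [_] := EAD _ Ex.
have [x Ex] := E0; have nDx : ~ D G1 x by have [] := EAD _ Ex.
case: (Gmax G2).
  split; first by move=> p Gp; left; right.
  have Nx : N (x, x) by split=> /=; [split; right|case].
  move=> /(_ (x, x, k (x, x))) h; apply: nDx; exists x, (k (x, x)); right; apply: h.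
  by right.
rewrite /P (_ : G0 `|` G2 = G2); last by apply/setUidPr => p G0p; left; left.
split; rewrite ?DG2.
- by move=> y [/DA//|/EAD[]].
- move=> y z Dy Dz; have [[Dy1 Dz1]|nDyz] := pselect (D G1 y /\ D G1 z).
    by have [w Dw Gw] := DX _ _ Dy1 Dz1; exists w; left.
  have Nyz : N (y, z) by [].
  by exists (k (y, z)); [right; exact: kE|right].
- move=> y z w [/DG[Dz Dw]|[/= Nyz ->]]; first by split; left.
  by split; [case: Nyz => -[]|right; exact: kE].
- move=> p q z [Gp|[/= Np zp]] [Gq|[/= Nq zq]].
  + exact: Ginj Gp Gq.
  + case: p Gp => p1 p2 /DG[_ Dz]; have := kE _ Nq; rewrite -zq => /EAD[_].
    by move=> /(_ Dz).
  + case: q Gq => p1 p2 /DG[_ Dz]; have := kE _ Np; rewrite -zp => /EAD[_].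
    by move=> /(_ Dz).
  + by apply: kinj => //; rewrite -zp -zq.
Qed.

Lemma card_bigcup_le {I T U : Type} (S : set I) (F : I -> set T) (C : set U) :
  infinite_set C -> S #<= C -> (forall i, S i -> F i #<= C) ->
  \bigcup_(i in S) F i #<= C.
Proof. by move=> /card_square; exact: card_bigcup_le_square. Qed.

Lemma card_setU_le {T U : Type} (A B : set T) (C : set U) : infinite_set C ->
  A #<= C -> B #<= C -> A `|` B #<= C.
Proof. by move=> Cinf; apply: card_setU_le_square => //; exact: card_square. Qed.

(** * Well-founded recursion and initial ordinals *)

(** The well-ordering principle, in the form suited to recursion. *)
Lemma exists_well_founded_order (T : Type) : exists lt : T -> T -> Prop,
  well_founded lt /\ forall x y, [\/ lt x y, x = y | lt y x].
Proof.
elim/Pchoice: T => T.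
have [R Rwo] := wochoice.well_ordering_principle T.
have Rwc : wochoice.wo_chain R (mem T) by move=> A _ /Rwo.
have Rtot x y : R x y || R y x by apply: (wochoice.wo_chainW Rwc).
have Ranti x y : R x y -> R y x -> x = y.
  by move=> xy yx; apply: (wochoice.wo_chain_antisymmetric Rwc); rewrite ?xy.
exists (fun x y => R x y /\ x <> y).
have min (A : set T) : A !=set0 -> exists2 z, A z & forall x, A x -> R z x.
  move=> [x Ax]; have [|z [[zA zmin] _]] := Rwo (mem A).
    by exists x; exact: mem_set.
  by exists z; [exact: set_mem|move=> y Ay; apply: zmin; exact: mem_set].
split.
- move=> x; apply: contrapT => nx.
  have [z nz zmin] := min [set x | ~ Acc (fun x y => R x y /\ x <> y) x] (ex_intro _ x nx).
  apply: nz; constructor => y [yz ney]; apply: contrapT => ny.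
  by apply: ney; apply: Ranti => //; exact: zmin.
- move=> x y; have [->|/eqP nxy] := eqVneq x y; first by constructor 2.
  have /orP[xy|yx] := Rtot x y; first by constructor 1.
  by constructor 3; split=> // yx'; exact: nxy.
Qed.

Lemma well_founded_min {K : Type} (lt : K -> K -> Prop) (S : set K) :
  well_founded lt -> S !=set0 -> exists2 a, S a & forall b, S b -> ~ lt b a.
Proof.
move=> wf [a0]; elim: (wf a0) => a _ IH Sa.
have [[b [ba Sb]]|nb] := pselect (exists b, lt b a /\ S b); first exact: IH ba Sb.
by exists a => // b Sb ba; apply: nb; exists b.
Qed.

(** A set A is enumerated injectively along its initial ordinal: among the
   initial segments of a well-order of A, and A itself, take the first that
   has the cardinality of A. *)
Lemma exists_initial_enumeration {T : Type} (A : set T) :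
  exists (K : Type) (lt : K -> K -> Prop) (h : K -> T),
  [/\ well_founded lt, forall x y, [\/ lt x y, x = y | lt y x],
      forall a, card_lt [set b | lt b a] A & range h = A /\ injective h].
Proof.
have [lt [wf tri]] := exists_well_founded_order A.
have AA : A #<= [set: A] by have /card_eqPle[] := card_setT A.
suff [D [DA Dseg]] : exists D : set A, A #<= D /\
    forall a, D a -> card_lt [set b | D b /\ lt b a] A.
  have DleA : D #<= A.
    apply: card_le_trans (subset_card_le (@subsetT _ D)) _.
    by have /card_eqPle[] := card_setT A.
  have /card_bijP[f fbij] := Cantor_Bernstein DleA DA.
  exists D, (fun x y => lt (val x) (val y)), (fun x => val (f x)); split.
  - have acc y : Acc lt y -> forall x : D, val x = y ->
        Acc (fun x y : D => lt (val x) (val y)) x.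
      elim=> {}y _ IH x xy; constructor => z; rewrite xy => zy.
      exact: IH zy _ erefl.
    by move=> x; exact: acc (wf (val x)) _ erefl.
  - move=> x y; have [xy|/val_inj->|xy] := tri (val x) (val y);
    by [constructor 1|constructor 2|constructor 3].
  - move=> a; apply: card_lt_transl (Dseg (val a) (set_valP a)).
    apply: (@card_le_inj _ _ _ _ val) => [x /= xa|x y _ _ /val_inj//].
    by split=> //; exact: set_valP.
  - split; last by move=> x y /val_inj; exact: bij_inj.
    apply/seteqP; split=> [_ [x _ <-]|x Ax]; first exact: set_valP.
    have [g fg gf] := fbij.
    by exists (g (SigSub (mem_set Ax))) => //; rewrite gf.
have [allsmall|/existsNP[a0 na0]] :=
    pselect (forall a, card_lt [set b | lt b a] A).
  exists setT; split=> // a _; apply: card_lt_transl (allsmall a).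
  by apply: subset_card_le => b [].
have [a na amin] := well_founded_min (S := [set a | ~ card_lt [set b | lt b a] A])
  wf (ex_intro _ a0 na0).
exists [set b | lt b a]; split.
  by apply: contrapT => /card_ltNge.
move=> b ba; apply: card_lt_transl (contrapT (fun nb => amin b nb ba)).
by apply: subset_card_le => c [].
Qed.

(** All the recursions below only require each new term to be related to every
   earlier one, so the recursion is driven by a binary relation Q. *)
Lemma wf_pairwise_choice {K T : Type} (t0 : T) (lt : K -> K -> Prop)
    (P : K -> T -> Prop) (Q : T -> T -> Prop) : well_founded lt ->
  (forall a (g : K -> T), (forall b, lt b a -> P b (g b)) ->
    exists t, P a t /\ forall b, lt b a -> Q (g b) t) ->
  exists f : K -> T, (forall a, P a (f a)) /\ forall b a, lt b a -> Q (f b) (f a).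
Proof.
elim/Pchoice: T => T in t0 P Q * => wf step.
pose ext a (rec : forall b, lt b a -> T) (b : K) : T :=
  if pselect (lt b a) is left ba then rec b ba else t0.
pose F a rec : T :=
  xget t0 [set t | P a t /\ forall b, lt b a -> Q (@ext a rec b) t].
pose f := Fix wf (fun=> T) F.
have fE a : f a = xget t0 [set t | P a t /\ forall b, lt b a -> Q (f b) t].
  rewrite /f Fix_eq => [|x u v uv].
    congr xget; apply/seteqP; split=> t [Pt Qt]; split=> // b ba.
      by have := Qt b ba; rewrite /ext; case: pselect.
    by rewrite /ext; case: pselect => // ?; exact: Qt.
  by congr F; apply/functional_extensionality_dep => y; apply/functional_extensionality_dep.
have fP a : P a (f a) /\ forall b, lt b a -> Q (f b) (f a).
  elim: (wf a) => {}a _ IH; rewrite fE.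
  exact: (xgetPex t0 (step a f (fun b ba => proj1 (IH b ba)))).
by exists f; split=> [a|b a]; [have [] := fP a|have [_] := fP a; exact].
Qed.

(** * The ordinal omega_2 *)

Lemma omega2_segment {d} {K : orderType d} {T : Type} (A : set T) (x : K) :
  is_aleph1 A -> is_omega2 K -> [set y | (y < x)%O] #<= A.
Proof.
move=> hA [_ [B hB BK] seg].
by apply: card_le_trans (card_succ_lt BK (seg x)) _; exact: aleph1_card_le.
Qed.

Lemma omega2_no_max {d} {K : orderType d} (x : K) :
  is_omega2 K -> exists y, (x < y)%O.
Proof.
move=> hK; have [_ [B hB [[_ KB] _]] _] := hK.
apply: contrapT => nx; apply: KB.
have -> : [set: K] = [set y | (y < x)%O] `|` [set x].
  apply/seteqP; split=> // y _; case: (ltgtP y x) => [|xy|->]; [by left| |by right].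
  by case: nx; exists y.
have Binf := aleph1_infinite hB.
apply: card_setU_le => //; first exact: omega2_segment.
by apply: card_le_trans (countable1 x) _; exact/infiniteP.
Qed.

(** The set of elements above x is club. *)
Lemma stationary_above {d} {K : orderType d} (E : set K) (x : K) :
  is_omega2 K -> stationary E -> exists2 y, E y & (x < y)%O.
Proof.
move=> hK sE; have [|y [Ey xy]] := sE [set y | (x < y)%O]; last by exists y.
split=> [y|y [[z zy] yP]].
  have [xy|yx] := ltP x y; first by exists y.
  by have [z xz] := omega2_no_max x hK; exists z => //; exact: le_trans yx (ltW xz).
rewrite /= ltNge; apply/negP => yx.
by have [w /= xw /andP[_ wy]] := yP z zy; move: (lt_trans xw wy); rewrite ltNge yx.
Qed.

(** * Eventual domination *)

Lemma ev_domP (f g : nat -> nat) :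
  ev_dom f g <-> exists N, forall n, (N <= n)%N -> (f n <= g n)%N.
Proof. by split=> [[N _ NP]|[N NP]]; exists N. Qed.

Lemma ev_dom_refl f : ev_dom f f.
Proof. by apply/ev_domP; exists 0%N. Qed.

Lemma ev_dom_trans f g h : ev_dom f g -> ev_dom g h -> ev_dom f h.
Proof.
move=> /ev_domP[M fg] /ev_domP[N gh]; apply/ev_domP; exists (maxn M N) => n.
by rewrite geq_max => /andP[Mn Nn]; exact: leq_trans (fg n Mn) (gh n Nn).
Qed.

Lemma ev_dom_maxl f g : ev_dom f (fun n => maxn (f n) (g n)).
Proof. by apply/ev_domP; exists 0%N => n _; exact: leq_maxl. Qed.

Lemma ev_dom_maxr f g : ev_dom g (fun n => maxn (f n) (g n)).
Proof. by apply/ev_domP; exists 0%N => n _; exact: leq_maxr. Qed.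

Lemma ev_dom_succN f : ~ ev_dom (fun n => (f n).+1) f.
Proof. by move=> /ev_domP[N /(_ N (leqnn N))]; rewrite ltnn. Qed.

Lemma ev_boundedU (A B : set (nat -> nat)) :
  ev_bounded A -> ev_bounded B -> ev_bounded (A `|` B).
Proof.
move=> [g gA] [h hB]; exists (fun n => maxn (g n) (h n)) => f [/gA fg|/hB fh].
  exact: ev_dom_trans fg (ev_dom_maxl _ _).
exact: ev_dom_trans fh (ev_dom_maxr _ _).
Qed.

(** The diagonal bound: at n, dominate the first n + 1 functions. *)
Lemma countable_ev_bounded (B : set (nat -> nat)) : countable B -> ev_bounded B.
Proof.
move=> /card_le_injP[|c _ cinj]; first by exists 0%N.
pose e k := xget (fun=> 0%N) [set f | B f /\ c f = k].
exists (fun n => \max_(k < n.+1) e k n) => f Bf.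
have ef : e (c f) = f.
  rewrite /e; case: xgetP => [g _ [Bg cg]|/(_ f)]; first exact: cinj.
  by case.
apply/ev_domP; exists (c f) => n fn.
rewrite -{1}ef; exact: (leq_bigmax (Ordinal (fn : c f < n.+1)%N)).
Qed.

Lemma Sh_uncountable (X : set (nat -> nat)) : Sh X -> ~ countable X.
Proof.
by move=> /(_ X (@subset_refl _ X)) [h _] /countable_ev_bounded /h /card_ltNge; apply.
Qed.

Lemma Sh_cofinal {r : rel (nat -> nat)} (X C : set (nat -> nat)) :
  (forall f g, r f g -> ev_dom f g) -> Sh X -> cofinal r X C -> X #<= C.
Proof.
move=> rE hX [CX Ccof]; apply: contrapT => /card_ltNge /(hX C CX) [g gC].
have [h _] := hX X (@subset_refl _ X).
suff /h/card_ltNge : ev_bounded X by apply.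
by exists g => f /Ccof[c Cc /rE fc]; exact: ev_dom_trans fc (gC c Cc).
Qed.

(** A scale of length b: along the initial ordinal of an unbounded family
   (h a) of least cardinality, choose f a above h a and strictly above all
   earlier f b; minimality of the family makes each choice possible. *)
Lemma exists_scale (r : rel (nat -> nat)) : (forall f g, r f g <-> ev_dom f g) ->
  exists2 X, Sh X & wochoice.wo_chain r (mem X).
Proof.
move=> rE.
have [|G [Gunb Gmin]] := @card_min_exists _ [set B | ~ ev_bounded B].
  exists setT => -[g gP]; apply: (@ev_dom_succN g); exact: gP.
have [K [lt [h [wf tri seg [hG hinj]]]]] := exists_initial_enumeration G.
have [|f [hf fP]] := @wf_pairwise_choice K _ (fun=> 0%N) lt
    (fun a t => ev_dom (h a) t) (fun s t => ev_dom (fun n => (s n).+1) t) wf.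
  move=> a g _.
  have [u uP] : ev_bounded [set (fun n => (g b n).+1) | b in [set b | lt b a]].
    apply: contrapT => /Gmin /(card_lt_transr (seg a)) /card_ltNge; apply.
    exact: card_image_le.
  exists (fun n => maxn (h a n) (u n)); split; first exact: ev_dom_maxl.
  move=> b ba; apply: ev_dom_trans (ev_dom_maxr _ _); apply: uP.
  by exists b.
have flt b a : lt b a -> ev_dom (f b) (f a).
  move=> /fP; apply: ev_dom_trans; apply/ev_domP; exists 0%N => n _; exact: leqnSn.
have fgt b a : lt b a -> ~ ev_dom (f a) (f b).
  by move=> /fP ba ab; exact: (ev_dom_succN (ev_dom_trans ba ab)).
have XG : range f #<= G.
  apply: card_le_trans (card_image_le _ _) _; apply: (@card_le_inj _ _ _ _ h).
    by move=> a _; rewrite -hG; exists a.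
  by move=> a b _ _; exact: hinj.
have GX : G #<= range f.
  apply: Gmin => -[u uP]; apply: Gunb; exists u; rewrite -hG => _ [a _ <-].
  by apply: ev_dom_trans (hf a) (uP _ _); exists a.
exists (range f).
  move=> B BX; split=> [[u uP]|BltX]; last first.
    apply: contrapT => /Gmin GB; have /card_ltNge := BltX; apply.
    exact: card_le_trans XG GB.
  (* A bound of cofinally many terms of the scale would bound G. *)
  have [a aP] : exists a, forall b, B (f b) -> lt b a.
    apply: contrapT => na; apply: Gunb; exists u; rewrite -hG => _ [a _ <-].
    apply: ev_dom_trans (hf a) _.
    have [b [Bb nba]] : exists b, B (f b) /\ ~ lt b a.
      apply: contrapT => nb; apply: na; exists a => b Bb; apply: contrapT => nba.
      by apply: nb; exists b.
    have [//|<-|ab] := tri b a; first exact: uP.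
    exact: ev_dom_trans (flt _ _ ab) (uP _ Bb).
  apply: (card_lt_transr _ GX); apply: card_lt_transl (seg a).
  apply: card_le_trans (card_image_le f _).
  apply: subset_card_le => x Bx; have [b _ fb] := BX _ Bx.
  by exists b => //=; apply: aP; rewrite fb.
apply: wochoice.antisymmetric_wo_chain.
  move=> x y /set_mem[a _ <-] /set_mem[b _ <-] /andP[/rE ab /rE ba].
  by have [/fgt|->|/fgt] := tri a b.
move=> A AX [x0 Ax0]; have [a0 _ fa0] := set_mem (AX _ Ax0).
have [|a Aa amin] := @well_founded_min _ lt [set a | f a \in A] wf.
  by exists a0; rewrite /= fa0.
exists (f a); split=> // y Ay; apply/rE.
have [b _ yb] := set_mem (AX _ Ay); rewrite -yb.
have [/flt//|->|] := tri a b; first exact: ev_dom_refl.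
by move=> /(amin b _) => h'; case: h'; rewrite /= yb.
Qed.

(** * Chains of length omega_2 *)

(** The common source of the long chains: below E, all sets of at most aleph_1
   points are bounded, but no aleph_1 bounds cover. *)
Lemma omega2_chain {d} {K : orderType d} {T X Y : Type} (A : set T)
    (PX : set X) (PY : set Y) (E : X -> Y -> Prop) :
  is_aleph1 A -> is_omega2 K ->
  (forall Z, Z `<=` PX -> Z #<= A -> exists2 y, PY y & forall x, Z x -> E x y) ->
  (forall S, S `<=` PY -> S #<= A -> exists2 x, PX x & forall y, S y -> ~ E x y) ->
  exists (f : K -> X) (g : K -> Y), [/\ forall a, PX (f a) /\ PY (g a),
    forall a b, (a < b)%O -> E (f a) (g b) &
    forall a b, (a < b)%O -> ~ E (f b) (g a)].
Proof.
move=> hA hK HE HnE.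
have [y0 _ _] := HE set0 (@sub0set _ _) (card_ge0 _ _).
have [x0 _ _] := HnE set0 (@sub0set _ _) (card_ge0 _ _).
have [wf _ _] := hK.
have [|h [hP hQ]] := @wf_pairwise_choice K (X * Y) (x0, y0) _
    (fun _ t => PX t.1 /\ PY t.2) (fun s t => E s.1 t.2 /\ ~ E t.1 s.2) wf.
  move=> a g gP.
  have seg U (k : X * Y -> U) : [set k (g b) | b in [set b | (b < a)%O]] #<= A.
    by apply: card_le_trans (card_image_le _ _) _; exact: omega2_segment.
  have [|y Py yP] := HE _ _ (seg _ fst); first by move=> _ [b /gP[? ?] <-].
  have [|x Px xP] := HnE _ _ (seg _ snd); first by move=> _ [b /gP[? ?] <-].
  exists (x, y); split=> // b ba; split; first by apply: yP; exists b.
  by apply: xP; exists b.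
exists (fst \o h), (snd \o h); split=> // a b ab; by have [] := hQ _ _ ab.
Qed.

(** Let D y be the part of X below y; it is bounded, hence smaller than X. A
   supply PY of bounds that bounds every subset of size aleph_1 and of which
   no aleph_1 members cover X gives a chain. If all functions are not such a
   supply, then X is covered by D y for aleph_1 many y. If moreover for each
   such y the bounds u with |D u| <= |D y| + aleph_1 are no such supply
   either, some Z y of size at most aleph_1 has no bound of this kind (aleph_1
   of these D u cannot cover X); but a bound u of the union of all Z y then
   has |D u| >= |D y| for all these y, so |X| <= aleph_1 * |D u| < |X|. *)
Lemma Sh_chain {d} {K : orderType d} {T : Type} (A : set T) (X : set (nat -> nat)) :
  is_aleph1 A -> is_omega2 K -> Sh X -> ~ (X #<= A) ->
  exists f g : K -> nat -> nat,
    (forall a b, (a < b)%O -> ev_dom (f a) (g b)) /\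
    (forall a b, (a < b)%O -> ~ ev_dom (f b) (g a)).
Proof.
move=> hA hK hX XA; apply: contrapT => nchain.
have AX : A #<= X := card_leNgt XA.
have Ainf := aleph1_infinite hA.
have small W : W `<=` X -> ev_bounded W -> ~ (X #<= W).
  by move=> WX /(hX W WX) /card_ltNge.
have bnd Z : Z `<=` X -> Z #<= A -> ev_bounded Z.
  move=> ZX ZA; apply/(hX Z ZX)/card_ltNge => XZ; apply: XA.
  exact: card_le_trans ZA.
pose D y := [set x | X x /\ ev_dom x y].
have Dbnd y : ev_bounded (D y) by exists y => x [].
have DX y : D y `<=` X by move=> x [].
have dich (PY : set (nat -> nat)) :
    (forall S, S `<=` PY -> S #<= A -> exists2 x, X x & forall y, S y -> ~ ev_dom x y) ->
    exists2 Z, Z `<=` X /\ Z #<= A & forall y, PY y -> ~ forall x, Z x -> ev_dom x y.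
  move=> H2; apply: contrapT => nZ; apply: nchain.
  have [|f [g [_ fg gf]]] := omega2_chain hA hK _ H2; last by exists f, g.
  move=> Z ZX ZA; apply: contrapT => ny; apply: nZ; exists Z => // y Py yP.
  by apply: ny; exists y.
have [B0 B0X B0A] := card_le_exists_subset AX.
have [AB0 B0leA] : A #<= B0 /\ B0 #<= A.
  by have /card_eqPle[] := B0A.
(* All functions bound every small subset of X, so aleph_1 of them cover X. *)
have [S SA Scov] : exists2 S : set (nat -> nat), S #<= A &
    forall x, X x -> exists2 y, S y & ev_dom x y.
  apply: contrapT => nS; have [|Z [ZX ZA] Zunb] := dich setT.
    move=> S _ SA; apply: contrapT => nx; apply: nS; exists S => // x Xx.
    apply: contrapT => ny; apply: nx; exists x => // y Sy xy.
    by apply: ny; exists y.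
  by have [y yP] := bnd Z ZX ZA; exact: (Zunb y).
(* W is D y enlarged to size at least aleph_1, so that aleph_1 sets of size |W|
   do not cover X; hence the bounds u with |D u| <= |W| leave some set of size
   at most aleph_1 unbounded. *)
have /choice[Z ZP] : forall y, exists Z, [/\ Z `<=` X, Z #<= A &
    forall y', (forall x, Z x -> ev_dom x y') -> D y `|` B0 #<= D y'].
  move=> y; set W := D y `|` B0.
  have WX : W `<=` X by move=> x [[]|/B0X].
  have Winf : infinite_set W.
    apply/infiniteP; apply: card_le_trans ((infiniteP _).1 Ainf) _.
    by apply: card_le_trans AB0 _; apply: subset_card_le; right.
  have AW : A #<= W.
    by apply: card_le_trans AB0 _; apply: subset_card_le; right.
  have Wsmall : ~ (X #<= W).
    by apply: small => //; apply: ev_boundedU => //; exact: bnd.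
  have [|Z [ZX ZA] Zunb] := dich [set y' | D y' #<= W].
    move=> S' S'W S'A; apply: contrapT => nx; apply: Wsmall.
    have XS : X `<=` \bigcup_(y' in S') D y'.
      move=> x Xx; apply: contrapT => nxS; apply: nx; exists x => // y' Sy' xy'.
      by apply: nxS; exists y'.
    apply: card_le_trans (subset_card_le XS) _.
    apply: card_bigcup_le => //; exact: card_le_trans AW.
  exists Z; split=> // y' y'P; apply: card_leNgt => DW.
  exact: Zunb y'P.
have [||u uP] := bnd (\bigcup_(y in S) Z y).
- by move=> x [y _]; have [+ _ _] := ZP y; apply.
- by apply: card_bigcup_le => // y _; have [] := ZP y.
have WDu y : S y -> D y `|` B0 #<= D u.
  by move=> Sy; have [_ _] := ZP y; apply => x Zx; apply: uP; exists y.
have [x0 Bx0] : B0 !=set0.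
  by apply: infinite_setN0; apply/infiniteP; apply: card_le_trans AB0; exact/infiniteP.
have [y0 Sy0 _] := Scov _ (B0X _ Bx0).
have ADu : A #<= D u.
  apply: card_le_trans AB0 _; apply: card_le_trans (WDu _ Sy0).
  by apply: subset_card_le; right.
apply: (small (D u)) => //.
have XS : X `<=` \bigcup_(y in S) D y.
  by move=> x Xx; have [y Sy xy] := Scov _ Xx; exists y.
apply: card_le_trans (subset_card_le XS) _.
apply: card_bigcup_le; last by move=> y /WDu; apply: card_le_trans; exact: subset_card_le.
  by apply/infiniteP; apply: card_le_trans ADu; exact/infiniteP.
exact: card_le_trans ADu.
Qed.

(** * The principles for matrices *)

(** Points of the plane are coded by pickle. Column 0 lies strictly above the
   graph of g a; column m.+1 consists of the points on or below the graph of f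
   a whose abscissa is at least m. *)
Definition gap_matrix {K : Type} (f g : K -> nat -> nat) (a : K) (n : nat) : set nat :=
  if n is m.+1 then
    [set pickle p | p in
      [set p : nat * nat | (m <= p.1)%N /\ (p.2 <= f a p.1)%N]]
  else [set pickle p | p in [set p : nat * nat | (g a p.1 < p.2)%N]].

Lemma gap_cap {K : Type} (f g : K -> nat -> nat) (a b : K) (m : nat) :
  matrix_cap (gap_matrix f g) [:: a; b] [:: m.+1; 0%N] =
  [set pickle p | p in [set p : nat * nat | (m <= p.1)%N /\ (g b p.1 < p.2 <= f a p.1)%N]].
Proof.
rewrite /matrix_cap /= big_cons big_cons big_nil setIT /=.
apply/seteqP; split=> [_ [[p [mp pf] <-] [q qg /(pcan_inj pickleK) e]]|].
  by exists p => //; split=> //; rewrite pf -e qg.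
by move=> _ [p [mp /andP[gp pf]] <-]; split; exists p.
Qed.

Lemma gap_cap_eq0 {K : Type} (f g : K -> nat -> nat) (a b : K) (m : nat) :
  matrix_cap (gap_matrix f g) [:: a; b] [:: m.+1; 0%N] = set0 <->
  forall n, (m <= n)%N -> (f a n <= g b n)%N.
Proof.
rewrite gap_cap; split=> [cap0 n mn|fg].
  rewrite leqNgt; apply/negP => gf.
  suff : set0 (pickle (n, f a n)) by [].
  by rewrite -cap0; exists (n, f a n) => //=; rewrite gf leqnn.
apply/seteqP; split=> // _ [[i j] /= [mi /andP[gj jf]] _].
by have := leq_trans gj (leq_trans jf (fg i mi)); rewrite ltnn.
Qed.

Lemma gap_cap_finite {K : Type} (f g : K -> nat -> nat) (a b : K) :
  finite_set (matrix_cap (gap_matrix f g) [:: a; b] [:: 1%N; 0%N]) <->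
  ev_dom (f a) (g b).
Proof.
rewrite gap_cap; split=> [fin|/ev_domP[N fg]].
  have /finite_seqP[s sP] : finite_set [set i | (g b i < f a i)%N].
    pose row k := if @unpickle (nat * nat)%type k is Some p then p.1 else 0%N.
    apply: sub_finite_set (finite_image row fin) => i /= gf.
    exists (pickle (i, f a i)); last by rewrite /row pickleK.
    by exists (i, f a i) => //=; rewrite gf leqnn.
  apply/ev_domP; exists (\max_(i <- s) i).+1 => n sn.
  rewrite leqNgt; apply/negP => gf; move: sn; rewrite ltnNge => /negP; apply.
  apply: (@leq_bigmax_seq _ s xpredT id) => //.
  by have : [set` s] n by rewrite -sP.
apply: (@sub_finite_set _ _ (\bigcup_(i in `I_N) (fun j => pickle (i, j)) @` `I_(f a i).+1)).
  move=> _ [[i j] /= [_ /andP[gj jf]] <-]; exists i; last by exists j.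
  rewrite /= ltnNge; apply/negP => Ni.
  by have := leq_trans gj (leq_trans jf (fg i Ni)); rewrite ltnn.
by apply: bigcup_finite => // i _; exact: finite_image.
Qed.

Lemma inj_prod2 {T : eqType} (E0 E1 : set T) (x y : T) :
  E0 x -> E1 y -> x != y -> inj_prod [:: E0; E1] [:: x; y].
Proof. by move=> Ex Ey xy; rewrite /inj_prod /= inE xy /= !mem_set. Qed.

Lemma inj_tuples2 {T : eqType} (E : set T) (x y : T) :
  E x -> E y -> x != y -> inj_tuples E [:: x; y].
Proof.
move=> Ex Ey xy; split; first by rewrite /= inE xy.
by move=> z; rewrite !inE => /orP[] /eqP ->.
Qed.

Lemma size_eq2P {T : Type} (s : seq T) : size s = 2 -> exists x y, s = [:: x; y].
Proof. by case: s => [|x [|y []]] // _; exists x, y. Qed.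

(** C^s is applied to the index sequences (m + 1, 0) for all m, its variant to
   (1, 0). For a < b the intersection at (a, b) is finite, and empty for large
   m, while at (b, a) it is infinite, and nonempty for all m. *)
Lemma Cs_no_chain {d} {K : orderType d} (f g : K -> nat -> nat) :
  is_omega2 K -> Cs K \/ Cs_hat K ->
  (forall a b, (a < b)%O -> ev_dom (f a) (g b)) ->
  (forall a b, (a < b)%O -> ~ ev_dom (f b) (g a)) -> False.
Proof.
move=> hK hC fg gf.
have pair (E0 E1 : set K) : stationary E0 -> stationary E1 ->
    exists a b, [/\ E0 a, E1 b & (a < b)%O].
  move=> sE0 sE1; have [|a [Ea _]] := sE0 setT; first by split=> // x; exists x.
  by have [b Eb ab] := stationary_above a hK sE1; exists a, b.
case: hC => [/(_ (gap_matrix f g) [set [:: m.+1; 0%N] | m in setT])|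
             /(_ (gap_matrix f g) [set [:: 1%N; 0%N]])].
  case=> [[E sE capE]|[_ [[m _ <-] [Es [/size_eq2P[E0 [E1 ->]] sE capE]]]]].
    have [a [b [Ea Eb ab]]] := pair _ _ sE sE.
    have /ev_domP[N fgN] := fg _ _ ab.
    have ne : matrix_cap (gap_matrix f g) [:: a; b] [:: N.+1; 0%N] !=set0.
      apply: capE; [by exists N| |by []].
      by apply: inj_tuples2 => //; rewrite lt_eqF.
    by have e := (gap_cap_eq0 f g a b N).2 fgN; rewrite e in ne; case: ne.
  have [||a [b [Ea Eb ab]]] := pair E1 E0; do ?[by apply: sE; rewrite !inE eqxx ?orbT].
  apply: (gf _ _ ab); apply/ev_domP; exists m; apply/(gap_cap_eq0 f g); apply: capE.
  by apply: inj_prod2 => //; rewrite gt_eqF.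
case=> [[E sE capE]|[_ [-> [Es [/size_eq2P[E0 [E1 ->]] sE capE]]]]].
  have [a [b [Ea Eb ab]]] := pair _ _ sE sE.
  apply: (gf _ _ ab); apply/(gap_cap_finite f g); apply: capE => //.
  by apply: inj_tuples2 => //; rewrite gt_eqF.
have [||a [b [Ea Eb ab]]] := pair E0 E1; do ?[by apply: sE; rewrite !inE eqxx ?orbT].
apply: (capE [:: a; b]); last by apply/(gap_cap_finite f g); exact: fg.
by apply: inj_prod2 => //; rewrite lt_eqF.
Qed.

(** * Sets up to extensional equality *)

Lemma Veq_refl x : Veq x x.
Proof. by elim: x => A f IH; split=> a; exists a. Qed.

Lemma Veq_sym x y : Veq x y -> Veq y x.
Proof.
elim: x y => A f IH [B g] [fg gf]; split=> [b|a].
  by have [a ab] := gf b; exists a; exact: IH.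
by have [b ab] := fg a; exists b; exact: IH.
Qed.

Lemma Veq_trans x y z : Veq x y -> Veq y z -> Veq x z.
Proof.
elim: x y z => A f IH [B g] [C h] [fg gf] [gh hg]; split=> [a|c].
  by have [b ab] := fg a; have [c bc] := gh b; exists c; exact: IH ab bc.
by have [b bc] := hg c; have [a ab] := gf b; exists a; exact: IH ab bc.
Qed.

Lemma Vin_Veq x x' y y' : Veq x x' -> Veq y y' -> Vin x y -> Vin x' y'.
Proof.
case: y y' => [A f] [B g] xx [fg _] [a xa]; have [b ab] := fg a; exists b.
exact: Veq_trans (Veq_sym xx) (Veq_trans xa ab).
Qed.

Lemma Vin_Veql x x' y : Veq x x' -> Vin x y -> Vin x' y.
Proof. by move=> xx; exact: Vin_Veq xx (Veq_refl y). Qed.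

Lemma Vin_Veqr x y y' : Veq y y' -> Vin x y -> Vin x y'.
Proof. exact: Vin_Veq (Veq_refl x). Qed.

Lemma Veq_ext x y : Veq x y <-> forall z, Vin z x <-> Vin z y.
Proof.
split=> [xy z|]; first by split; apply: Vin_Veqr => //; exact: Veq_sym.
case: x y => [A f] [B g] fg; split=> [a|b].
  by have [+ _] := fg (f a); apply; exists a; exact: Veq_refl.
have [_] := fg (g b); case; first by exists b; exact: Veq_refl.
by move=> a; exists a; exact: Veq_sym.
Qed.

Lemma Vin_irrefl x : ~ Vin x x.
Proof.
elim: x => A f IH [a fa]; apply: (IH a).
by apply: (Vin_Veq fa fa); exists a.
Qed.

Lemma VemptyP z : ~ Vin z Vempty.
Proof. by case. Qed.

Lemma Vin_pair z x y : Vin z (Vpair x y) <-> Veq z x \/ Veq z y.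
Proof.
by split=> [[[] ?]|[?|?]]; [left|right|exists true|exists false].
Qed.

Lemma Vpair_Veq x x' y y' : Veq x x' -> Veq y y' -> Veq (Vpair x y) (Vpair x' y').
Proof. by move=> xx yy; split=> -[]; [exists true|exists false|exists true|exists false]. Qed.

Lemma Vopair_Veq x x' y y' : Veq x x' -> Veq y y' -> Veq (Vopair x y) (Vopair x' y').
Proof. by move=> xx yy; apply: Vpair_Veq; exact: Vpair_Veq. Qed.

Lemma Vpair_inj x y x' y' : Veq (Vpair x y) (Vpair x' y') ->
  Veq x x' /\ Veq y y' \/ Veq x y' /\ Veq y x'.
Proof.
move=> /Veq_ext h.
have hx := (h x).1 ((Vin_pair _ _ _).2 (or_introl (Veq_refl x))).
have hy := (h y).1 ((Vin_pair _ _ _).2 (or_intror (Veq_refl y))).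
have hx' := (h x').2 ((Vin_pair _ _ _).2 (or_introl (Veq_refl x'))).
have hy' := (h y').2 ((Vin_pair _ _ _).2 (or_intror (Veq_refl y'))).
move: hx hy hx' hy' => /Vin_pair hx /Vin_pair hy /Vin_pair hx' /Vin_pair hy'.
case: hx => [xx'|xy']; case: hy => [yx'|yy']; [|by left|by right|].
  case: hy' => [y'x|y'y]; first by right; split=> //; exact: Veq_sym.
  by left; split=> //; exact: Veq_sym.
case: hx' => [x'x|x'y]; first by left; split=> //; exact: Veq_sym.
by right; split=> //; exact: Veq_sym.
Qed.

Lemma Vopair_inj x y x' y' :
  Veq (Vopair x y) (Vopair x' y') -> Veq x x' /\ Veq y y'.
Proof.
move=> /Vpair_inj[[/Vpair_inj xx /Vpair_inj xy]|[/Vpair_inj xx /Vpair_inj xy]].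
  have {}xx : Veq x x' by case: xx => -[].
  split=> //; case: xy => -[] // xy' yx'.
  exact: Veq_trans yx' (Veq_trans (Veq_sym xx) xy').
have [xx' xy'] : Veq x x' /\ Veq x y' by case: xx => -[].
split=> //; have yx' : Veq y x' by case: xy => -[].
exact: Veq_trans yx' (Veq_trans (Veq_sym xx') xy').
Qed.

Lemma Vin_succ z x : Vin z (Vsucc x) <-> Vin z x \/ Veq z x.
Proof.
case: x => A f; split=> [[[a|] h]|[[a h]|h]].
- by left; exists a.
- by right.
- by exists (Some a).
- by exists None.
Qed.

Lemma Vin_nat z n : Vin z (Vnat n) <-> exists2 m, (m < n)%N & Veq z (Vnat m).
Proof.
elim: n => [|n IH]; first by split=> [/VemptyP//|[]].
split=> [/Vin_succ[/IH[m mn zm]|zn]|[m]].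
- by exists m => //; exact: ltnW.
- by exists n.
rewrite ltnS leq_eqVlt => /orP[/eqP ->|mn] zm; apply/Vin_succ; first by right.
by left; apply/IH; exists m.
Qed.

Lemma Vnat_inj m n : Veq (Vnat m) (Vnat n) -> m = n.
Proof.
wlog mn : m n / (m < n)%N => [wl e|].
  by have [/wl->//|/wl->//|//] := ltngtP m n; exact: Veq_sym.
move=> e; case: (@Vin_irrefl (Vnat m)); apply: (Vin_Veqr (Veq_sym e)).
by apply/Vin_nat; exists m => //; exact: Veq_refl.
Qed.

Lemma Vin_nat2 m n : Vin (Vnat m) (Vnat n) <-> (m < n)%N.
Proof.
split=> [/Vin_nat[k kn /Vnat_inj->//]|mn].
by apply/Vin_nat; exists m => //; exact: Veq_refl.
Qed.

Lemma Vin_set z (X : set nat) : Vin z (Vset X) <-> exists2 n, X n & Veq z (Vnat n).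
Proof.
split=> [[[n Xn] zn]|[n Xn zn]]; first by exists n.
by exists (exist _ n Xn).
Qed.

Lemma Vin_set2 n (X : set nat) : Vin (Vnat n) (Vset X) <-> X n.
Proof.
split=> [/Vin_set[m Xm /Vnat_inj->//]|Xn].
by apply/Vin_set; exists n => //; exact: Veq_refl.
Qed.

Lemma Vin_fun z (f : nat -> nat) :
  Vin z (Vfun f) <-> exists n, Veq z (Vopair (Vnat n) (Vnat (f n))).
Proof. by []. Qed.

Lemma Vin_seq z (s : seq V) : Vin z (Vseq s) <->
  exists2 i, (i < size s)%N & Veq z (Vopair (Vnat i) (nth Vempty s i)).
Proof.
split=> [[[n sn] zn]|[n sn zn]]; first by exists n.
by exists (exist _ n sn).
Qed.

(** * Hereditarily countable sets *)

Local Notation hc := hered_countable.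

Lemma trans_closure_Veq x x' y : Veq x x' -> trans_closure x y -> trans_closure x' y.
Proof.
move=> xx; elim=> [z zx|z w _ zx wz]; first by apply: tc_base; exact: Vin_Veqr zx.
exact: tc_step zx wz.
Qed.

Lemma hc_Veq x x' : Veq x x' -> hc x -> hc x'.
Proof.
move=> xx [g gP]; exists g => y yx; apply: gP.
exact: trans_closure_Veq (Veq_sym xx) yx.
Qed.

Lemma hc_in x y : hc x -> Vin y x -> hc y.
Proof.
move=> [g gP] yx; exists g => z zy; apply: gP.
elim: zy => [w wy|w v _ wx vw]; last exact: tc_step wx vw.
by apply: tc_step wy; exact: tc_base.
Qed.

(** A transitive closure is enumerated from enumerations of the transitive
   closures of the elements. *)
Lemma hc_intro x (g : nat -> V) :
  (forall y, Vin y x -> hc y /\ exists n, Veq y (g n)) -> hc x.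
Proof.
move=> xg.
have /choice[G GP] : forall y, exists G : nat -> V, hc y ->
    forall z, trans_closure y z -> exists n, Veq z (G n).
  move=> y; have [[G GP]|nhc] := pselect (hc y); first by exists G.
  by exists g.
pose h (p : nat * nat) := if p.2 is m.+1 then G (g p.1) m else g p.1.
suff hP y : trans_closure x y -> exists p, Veq y (h p).
  exists (fun k => if unpickle k is Some p then h p else Vempty) => y /hP[p yp].
  by exists (pickle p); rewrite pickleK.
move=> xy; have [/xg[_ [n yn]]|[w [/xg[whc [n wn]] wy]]] :
    Vin y x \/ exists w, Vin w x /\ trans_closure w y.
- elim: xy => [z zx|z w _ [zx|[v [vx vz]]] wz]; first by left.
    by right; exists z; split=> //; exact: tc_base.
  by right; exists v; split=> //; exact: tc_step vz wz.
- by exists (n, 0%N).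
have [m ym] := GP _ (hc_Veq wn whc) _ (trans_closure_Veq wn wy).
by exists (n, m.+1).
Qed.

Lemma hc_empty : hc Vempty.
Proof. by apply: (@hc_intro _ (fun=> Vempty)) => y /VemptyP. Qed.

Lemma hc_nat n : hc (Vnat n).
Proof.
elim/ltn_ind: n => n IH; apply: (@hc_intro _ Vnat) => y /Vin_nat[m mn ym].
by split; [exact: hc_Veq (Veq_sym ym) (IH m mn)|exists m].
Qed.

Lemma hc_pair x y : hc x -> hc y -> hc (Vpair x y).
Proof.
move=> hx hy; apply: (@hc_intro _ (fun n => if n is 0%N then x else y)).
move=> z /Vin_pair[zx|zy]; split.
- exact: hc_Veq (Veq_sym zx) hx.
- by exists 0%N.
- exact: hc_Veq (Veq_sym zy) hy.
- by exists 1%N.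
Qed.

Lemma hc_opair x y : hc x -> hc y -> hc (Vopair x y).
Proof. by move=> hx hy; do ?apply: hc_pair. Qed.

Lemma hc_opair_inv x y : hc (Vopair x y) -> hc x /\ hc y.
Proof.
move=> h; have hxy : hc (Vpair x y).
  by apply: hc_in h _; apply/Vin_pair; right; exact: Veq_refl.
by split; apply: (hc_in hxy); apply/Vin_pair; [left|right]; exact: Veq_refl.
Qed.

Lemma hc_nat_family (f : nat -> V) : (forall n, hc (f n)) -> hc (Sup f).
Proof.
move=> hf; apply: (@hc_intro _ f) => y [n yn].
by split; [exact: hc_Veq (Veq_sym yn) (hf n)|exists n].
Qed.

Lemma hc_set X : hc (Vset X).
Proof.
apply: (@hc_intro _ Vnat) => y /Vin_set[n _ yn].
by split; [exact: hc_Veq (Veq_sym yn) (hc_nat n)|exists n].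
Qed.

Lemma hc_fun f : hc (Vfun f).
Proof. by apply: hc_nat_family => n; apply: hc_opair; exact: hc_nat. Qed.

Lemma hc_seq s : (forall i, hc (nth Vempty s i)) -> hc (Vseq s).
Proof.
move=> hs; apply: (@hc_intro _ (fun n => Vopair (Vnat n) (nth Vempty s n))).
move=> y /Vin_seq[n _ yn]; split; last by exists n.
by apply: hc_Veq (Veq_sym yn) _; apply: hc_opair => //; exact: hc_nat.
Qed.

(** * Formulas *)

Fixpoint frename (r : nat -> nat) (p : formula) : formula :=
  match p with
  | FIn i j => FIn (r i) (r j)
  | FEq i j => FEq (r i) (r j)
  | FNot p => FNot (frename r p)
  | FAnd p q => FAnd (frename r p) (frename r q)
  | FEx p => FEx (frename (fun i => if i is j.+1 then (r j).+1 else 0%N) p)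
  end.

(** Renaming places a given formula under additional quantifiers; allowing
   values that are only extensionally equal makes it also the invariance
   lemma. *)
Lemma sat_rename p (r : nat -> nat) e e' :
  (forall i, Veq (nth Vempty e (r i)) (nth Vempty e' i)) ->
  sat e (frename r p) <-> sat e' p.
Proof.
elim: p r e e' => /= [i j|i j|p IH|p IHp q IHq|p IH] r e e' re.
- by split; apply: Vin_Veq => //; exact: Veq_sym.
- split=> h; first exact: Veq_trans (Veq_sym (re i)) (Veq_trans h (re j)).
  exact: Veq_trans (re i) (Veq_trans h (Veq_sym (re j))).
- by rewrite (IH _ _ _ re).
- by rewrite (IHp _ _ _ re) (IHq _ _ _ re).
- have ext x i : Veq (nth Vempty (x :: e) (if i is j.+1 then (r j).+1 else 0%N))
      (nth Vempty (x :: e') i) by case: i => [|i]; [exact: Veq_refl|exact: re].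
  by split=> -[x hx /(IH _ _ _ (ext x)) px]; exists x => //; apply/(IH _ _ _ (ext x)).
Qed.

Lemma frename_id p : frename id p = p.
Proof.
elim: p => //= [p ->|p -> q ->|p IH] //; rewrite -[in RHS]IH.
by congr (FEx (frename _ p)); apply/funext => -[].
Qed.

Lemma sat_Veq p e e' : (forall i, Veq (nth Vempty e i) (nth Vempty e' i)) ->
  sat e p <-> sat e' p.
Proof. by move=> /(sat_rename p (r := id)); rewrite frename_id. Qed.

Definition FImp p q := FNot (FAnd p (FNot q)).
Definition FOr p q := FNot (FAnd (FNot p) (FNot q)).
Definition FIff p q := FAnd (FImp p q) (FImp q p).
Definition FAll p := FNot (FEx (FNot p)).
Definition FExIn i p := FEx (FAnd (FIn 0 i.+1) p).
Definition FAllIn i p := FAll (FImp (FIn 0 i.+1) p).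

Arguments FImp : simpl never.
Arguments FOr : simpl never.
Arguments FIff : simpl never.
Arguments FAll : simpl never.
Arguments FExIn : simpl never.
Arguments FAllIn : simpl never.

Lemma sat_imp e p q : sat e (FImp p q) <-> (sat e p -> sat e q).
Proof.
split=> /= [h hp|h [hp]]; last by apply; exact: h.
by apply: contrapT => nq; apply: h.
Qed.

Lemma sat_or e p q : sat e (FOr p q) <-> sat e p \/ sat e q.
Proof.
split=> /= [h|[hp|hq] [np nq]]; [|exact: np|exact: nq].
by apply: contrapT => /not_orP[? ?]; apply: h.
Qed.

Lemma sat_iff e p q : sat e (FIff p q) <-> (sat e p <-> sat e q).
Proof.
split=> [[/sat_imp pq /sat_imp qp]|[pq qp]]; first by split.
by split; apply/sat_imp.
Qed.

Lemma sat_all e p : sat e (FAll p) <-> forall x, hc x -> sat (x :: e) p.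
Proof.
split=> /= [h x hx|h [x hx]]; last by apply; exact: h.
by apply: contrapT => nx; apply: h; exists x.
Qed.

Lemma sat_exin e i p : hc (nth Vempty e i) ->
  sat e (FExIn i p) <-> exists2 x, Vin x (nth Vempty e i) & sat (x :: e) p.
Proof.
move=> hi; split=> [[x hx [xi px]]|[x xi px]]; first by exists x.
by exists x => //; exact: hc_in xi.
Qed.

Lemma sat_allin e i p : hc (nth Vempty e i) ->
  sat e (FAllIn i p) <-> forall x, Vin x (nth Vempty e i) -> sat (x :: e) p.
Proof.
move=> hi; split=> [/sat_all h x xi|h].
  by have /sat_imp := h x (hc_in hi xi); apply.
by apply/sat_all => x _; apply/sat_imp; exact: h.
Qed.

(** The environments for which the combinators below have their intended
   meaning: quantifiers over the structure then reach all elements of the sets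
   involved. A combinator such as FOpair z x y takes the indices of its free
   variables in the environment where it stands. *)
Definition henv (e : seq V) := forall i, hc (nth Vempty e i).

Lemma henv_nil : henv [::].
Proof. by move=> i; rewrite nth_nil; exact: hc_empty. Qed.

Lemma henv_cons x e : hc x -> henv e -> henv (x :: e).
Proof. by move=> hx he [|i] //=. Qed.

Lemma henv_in x e i : henv e -> Vin x (nth Vempty e i) -> henv (x :: e).
Proof. by move=> he xi; apply: henv_cons => //; exact: hc_in xi. Qed.

Definition FPair z x y := FAll (FIff (FIn 0 z.+1) (FOr (FEq 0 x.+1) (FEq 0 y.+1))).
(** The two quantified sets are {x, y} (variable 1) and {x} (variable 0). *)
Definition FOpair z x y :=
  FEx (FEx (FAnd (FPair 0 x.+2 x.+2) (FAnd (FPair 1 x.+2 y.+2) (FPair z.+2 0 1)))).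

Arguments FPair : simpl never.
Arguments FOpair : simpl never.

Lemma sat_pair e z x y : henv e -> sat e (FPair z x y) <->
  Veq (nth Vempty e z) (Vpair (nth Vempty e x) (nth Vempty e y)).
Proof.
move=> he; split=> [/sat_all h|/Veq_ext h].
  apply/Veq_ext => u; split=> [uz|/Vin_pair uxy].
    have /sat_iff[/(_ uz) + _] := h u (hc_in (he z) uz).
    by move=> /sat_or /= uxy; apply/Vin_pair.
  have hu : hc u by case: uxy => /Veq_sym ue; exact: hc_Veq ue (he _).
  by have /sat_iff[_] := h u hu; apply; apply/sat_or.
apply/sat_all => u _; apply/sat_iff; split=> [uz|/sat_or /= uxy].
  by apply/sat_or; move: uz => /= /h /Vin_pair.
by apply/h/Vin_pair.
Qed.

Lemma sat_opair e z x y : henv e -> sat e (FOpair z x y) <->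
  Veq (nth Vempty e z) (Vopair (nth Vempty e x) (nth Vempty e y)).
Proof.
move=> he; split=> [[p hp [q hq [qP [pP zP]]]]|zxy].
  have he' : henv [:: q, p & e] by do ?apply: henv_cons.
  move: qP pP zP => /(sat_pair _ _ _ he') qP /(sat_pair _ _ _ he') pP /(sat_pair _ _ _ he') zP.
  by apply: Veq_trans zP _; exact: Vpair_Veq.
have hp := hc_pair (he x) (he y); have hq := hc_pair (he x) (he x).
exists (Vpair (nth Vempty e x) (nth Vempty e y)) => //.
exists (Vpair (nth Vempty e x) (nth Vempty e x)) => //.
have he' := henv_cons hq (henv_cons hp he).
by do ![split]; apply/(sat_pair _ _ _ he'); [exact: Veq_refl|exact: Veq_refl|exact: zxy].
Qed.

Definition FInPair x y z := FExIn z (FOpair 0 x.+1 y.+1).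

Arguments FInPair : simpl never.

Lemma sat_inpair e x y z : henv e -> sat e (FInPair x y z) <->
  Vin (Vopair (nth Vempty e x) (nth Vempty e y)) (nth Vempty e z).
Proof.
move=> he; split=> [/(sat_exin _ (he z))[u uz /(sat_opair _ _ _ (henv_in he uz)) up]|h].
  exact: Vin_Veql up uz.
apply/(sat_exin _ (he z)); exists (Vopair (nth Vempty e x) (nth Vempty e y)) => //.
by apply/(sat_opair _ _ _ (henv_in he h)); exact: Veq_refl.
Qed.

(** * The formula for increasing tuples *)

Definition set_definable (E : set nat -> set nat -> Prop) :=
  exists (p : formula) (b : V), hc b /\
    forall s t, sat [:: Vset s; Vset t; b] p <-> E s t.

Definition Vomega : V := Vset setT.

(** The next formulas are evaluated where variable 0 is a natural number n,
   1 the parameter b, 2 the set w of natural numbers and 3 the set x; they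
   express that x is a tuple of length n of subsets of w that
   is strictly increasing for the relation defined by p. *)
Section tuple_formula.
Variables n b w x a : V.
Hypothesis he : henv [:: n; b; w; x; a].

Let hn : hc n := he 0. Let hb : hc b := he 1.
Let hx : hc x := he 3.

Definition Fentries :=
  FAllIn 3 (FExIn 1 (FEx (FAnd (FAllIn 0 (FIn 0 6)) (FOpair 2 1 0)))).

Lemma sat_entries : sat [:: n; b; w; x; a] Fentries <->
  forall u, Vin u x -> exists i y,
    [/\ Vin i n, forall z, Vin z y -> Vin z w & Veq u (Vopair i y)].
Proof.
split=> [/(sat_allin _ (he 3)) h u ux|h].
  have hu := hc_in hx ux; have := h u ux.
  move=> /(sat_exin _ (henv_cons hu he 1))[i iin [y hy [yw uy]]].
  have hi := hc_in hn iin.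
  have he' := henv_cons hy (henv_cons hi (henv_cons hu he)).
  exists i, y; split=> //; last exact: (sat_opair 2 1 0 he').1 uy.
  exact: (sat_allin (FIn 0 6) (he' 0)).1 yw.
apply/(sat_allin _ (he 3)) => u ux; have hu := hc_in hx ux.
have [i [y [iin yw uy]]] := h u ux.
apply/(sat_exin _ (henv_cons hu he 1)); exists i => //.
have [hi hy] := hc_opair_inv (hc_Veq uy hu).
have he' := henv_cons hy (henv_cons hi (henv_cons hu he)).
exists y => //; split; last exact/(sat_opair 2 1 0 he').
exact/(sat_allin _ (he' 0)).
Qed.

Definition Ftotal := FAllIn 0 (FEx (FInPair 1 0 5)).

Lemma sat_total : sat [:: n; b; w; x; a] Ftotal <->
  forall i, Vin i n -> exists y, Vin (Vopair i y) x.
Proof.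
split=> [/(sat_allin _ (he 0)) h i iin|h].
  have [y hy iy] := h i iin; exists y.
  exact: (sat_inpair 1 0 5 (henv_cons hy (henv_in (i := 0) he iin))).1 iy.
apply/(sat_allin _ (he 0)) => i iin; have [y iyx] := h i iin.
have [_ hy] := hc_opair_inv (hc_in hx iyx).
exists y => //; exact/(sat_inpair 1 0 5 (henv_cons hy (henv_in (i := 0) he iin))).
Qed.

Definition Ffunctional :=
  FAll (FAll (FAll (FImp (FInPair 2 1 6) (FImp (FInPair 2 0 6) (FEq 1 0))))).

Lemma sat_functional : sat [:: n; b; w; x; a] Ffunctional <->
  forall i y y', Vin (Vopair i y) x -> Vin (Vopair i y') x -> Veq y y'.
Proof.
split=> [/sat_all h i y y' iy iy'|h].
  have [hi hy] := hc_opair_inv (hc_in hx iy).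
  have [_ hy'] := hc_opair_inv (hc_in hx iy').
  have he' := henv_cons hy' (henv_cons hy (henv_cons hi he)).
  have /sat_all/(_ y hy)/sat_all/(_ y' hy')/sat_imp := h i hi.
  move=> /(_ ((sat_inpair 2 1 6 he').2 iy))/sat_imp.
  exact: (fun g => g ((sat_inpair 2 0 6 he').2 iy')).
apply/sat_all => i hi; apply/sat_all => y hy; apply/sat_all => y' hy'.
have he' := henv_cons hy' (henv_cons hy (henv_cons hi he)).
apply/sat_imp => /(sat_inpair 2 1 6 he') iy.
apply/sat_imp => /(sat_inpair 2 0 6 he') iy'.
exact: h iy iy'.
Qed.

Variable p : formula.

(** Under the four quantifiers the entries y and y' are the variables 1 and 0,
   and b is variable 5. All other variables of p are sent beyond the end of
   the environment, where they denote the empty set, as they do in the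
   environment of p. *)
Definition Fincreasing := FAll (FAll (FAll (FAll
  (FImp (FInPair 3 1 7) (FImp (FInPair 2 0 7) (FImp (FIn 3 2)
    (FAnd (frename (fun i => nth (i + 6) [:: 1; 0; 5] i) p)
          (FNot (frename (fun i => nth (i + 6) [:: 0; 1; 5] i) p))))))))).

Lemma sat_increasing : sat [:: n; b; w; x; a] Fincreasing <->
  forall i j y y', Vin (Vopair i y) x -> Vin (Vopair j y') x -> Vin i j ->
    sat [:: y; y'; b] p /\ ~ sat [:: y'; y; b] p.
Proof.
have ren y y' i j :
    (sat [:: y'; y; j; i; n; b; w; x; a] (frename (fun i => nth (i + 6) [:: 1; 0; 5] i) p)
      <-> sat [:: y; y'; b] p) /\
    (sat [:: y'; y; j; i; n; b; w; x; a] (frename (fun i => nth (i + 6) [:: 0; 1; 5] i) p)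
      <-> sat [:: y'; y; b] p).
  have tail (k : nat) : nth Vempty [:: y'; y; j; i; n; b; w; x; a] (k.+3 + 6) = Vempty.
    by rewrite nth_default // addnC.
  split; apply: sat_rename.
    move=> [|[|[|k]]]; try exact: Veq_refl.
    by rewrite [nth (k.+3 + 6) _ _]nth_default // tail nth_default //; exact: Veq_refl.
  move=> [|[|[|k]]]; try exact: Veq_refl.
  by rewrite [nth (k.+3 + 6) _ _]nth_default // tail nth_default //; exact: Veq_refl.
split=> [/sat_all h i j y y' iy jy' ij|h].
  have [hi hy] := hc_opair_inv (hc_in hx iy).
  have [hj hy'] := hc_opair_inv (hc_in hx jy').
  have he' := henv_cons hy' (henv_cons hy (henv_cons hj (henv_cons hi he))).
  have [r1 r2] := ren y y' i j.
  have /sat_all/(_ j hj)/sat_all/(_ y hy)/sat_all/(_ y' hy')/sat_imp := h i hi.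
  move=> /(_ ((sat_inpair 3 1 7 he').2 iy))/sat_imp.
  move=> /(_ ((sat_inpair 2 0 7 he').2 jy'))/sat_imp/(_ ij)[e1 e2].
  by split; [exact/r1|move/r2].
apply/sat_all => i hi; apply/sat_all => j hj.
apply/sat_all => y hy; apply/sat_all => y' hy'.
have he' := henv_cons hy' (henv_cons hy (henv_cons hj (henv_cons hi he))).
have [r1 r2] := ren y y' i j.
apply/sat_imp => /(sat_inpair 3 1 7 he') iy.
apply/sat_imp => /(sat_inpair 2 0 7 he') jy'.
apply/sat_imp => ij; have [e1 e2] := h i j y y' iy jy' ij.
by split; [exact/r1|move/r2].
Qed.
End tuple_formula.

Definition increasing_tuple (E : set nat -> set nat -> Prop) (s : seq (set nat)) :=
  forall i j, (i < j < size s)%N ->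
    E (nth set0 s i) (nth set0 s j) /\ ~ E (nth set0 s j) (nth set0 s i).

Definition Ftuple p := FEx (FEx (FAnd (FOpair 3 1 0)
  (FExIn 1 (FAnd Fentries (FAnd Ftotal (FAnd Ffunctional (Fincreasing p))))))).

Lemma nth_map_Vset s i : (i < size s)%N ->
  nth Vempty (map Vset s) i = Vset (nth set0 s i).
Proof. by move=> si; rewrite (nth_map set0). Qed.

(** An entry y of the tuple x is extensionally the set of all m whose numeral
   belongs to y, which gives back the tuple s. *)
Lemma sat_tuple E p b x : hc x -> hc b ->
  (forall s t, sat [:: Vset s; Vset t; b] p <-> E s t) ->
  sat [:: x; Vopair Vomega b] (Ftuple p) <->
  exists2 s, increasing_tuple E s & Veq x (Vseq (map Vset s)).
Proof.
move=> hx hb pE; set a := Vopair Vomega b.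
have ha : hc a by apply: hc_opair => //; exact: hc_set.
have ext y y' c s t : Veq y (Vset s) -> Veq y' (Vset t) -> Veq b c ->
    sat [:: y; y'; c] p <-> E s t.
  move=> ys yt bc; rewrite -pE; apply: sat_Veq => -[|[|[|k]]] //=.
    exact: Veq_sym.
  by rewrite nth_nil.
split=> [[w hw [c hc' [abw [n hn [nw]]]]]|[s sinc xs]].
  have he0 : henv [:: c; w; x; a] by do !apply: henv_cons => //; exact: henv_nil.
  have [ww bc] := Vopair_inj ((sat_opair 3 1 0 he0).1 abw).
  have he := henv_cons hn he0.
  move=> [/(sat_entries he) xent [/(sat_total he) xtot]].
  move=> [/(sat_functional he) xfun /(sat_increasing he) xinc].
  have [N _ nN] := (Vin_set _ _).1 (Vin_Veqr (Veq_sym ww) nw).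
  have inn i : Vin (Vnat i) n <-> (i < N)%N.
    split=> [h|iN]; first by apply/Vin_nat2; exact: Vin_Veqr nN h.
    by apply: Vin_Veqr (Veq_sym nN) _; exact/Vin_nat2.
  have /choice[y yP] : forall i, exists y, (i < N)%N -> Vin (Vopair (Vnat i) y) x.
    move=> i; have [iN|] := ltnP i N; last by exists Vempty.
    by have [y yx] := xtot _ ((inn i).2 iN); exists y.
  pose t i := [set m | Vin (Vnat m) (y i)].
  have yt i : (i < N)%N -> Veq (y i) (Vset (t i)).
    move=> iN; have [i' [y' [i'n y'w /Vopair_inj[ii' yy']]]] := xent _ (yP i iN).
    apply/Veq_ext => z; split=> [zy|/Vin_set[m tm zm]]; last first.
      exact: Vin_Veql (Veq_sym zm) tm.
    have /(Vin_Veqr (Veq_sym ww))/Vin_set[m _ zm] := y'w _ (Vin_Veqr yy' zy).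
    by apply/Vin_set; exists m => //; exact: Vin_Veql zm zy.
  exists (mkseq t N).
    move=> i j; rewrite size_mkseq => /andP[ij jN].
    have iN := ltn_trans ij jN; rewrite !nth_mkseq //.
    have := xinc _ _ _ _ (yP i iN) (yP j jN) ((Vin_nat2 _ _).2 ij).
    by rewrite (ext _ _ _ (t i) (t j)) ?(ext _ _ _ (t j) (t i)) //; exact: yt.
  apply/Veq_ext => z; split=> [zx|/Vin_seq[i]].
    have [i' [y' [i'n y'w zy']]] := xent _ zx.
    have /Vin_nat[i iN i'i] := Vin_Veqr nN i'n.
    apply/Vin_seq; exists i; first by rewrite size_map size_mkseq.
    rewrite nth_map_Vset ?size_mkseq // nth_mkseq //.
    apply: Veq_trans (zy') _; apply: Vopair_Veq => //.
    apply: Veq_trans (yt i iN); apply: xfun (yP i iN).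
    apply: Vin_Veql zx; apply: Veq_trans zy' _; apply: Vopair_Veq => //.
    exact: Veq_refl.
  rewrite size_map size_mkseq => iN.
  rewrite nth_map_Vset ?size_mkseq // nth_mkseq // => zi.
  apply: Vin_Veql (yP i iN); apply: Veq_sym; apply: Veq_trans zi _.
  by apply: Vopair_Veq; [exact: Veq_refl|exact: Veq_sym (yt i iN)].
have hw : hc Vomega by exact: hc_set.
have he0 : henv [:: b; Vomega; x; a] by do !apply: henv_cons => //; exact: henv_nil.
exists Vomega => //; exists b => //; split.
  by apply/(sat_opair 3 1 0 he0); exact: Veq_refl.
have he := henv_cons (hc_nat (size s)) he0.
have xin i y : Vin (Vopair i y) x -> exists k, [/\ (k < size s)%N, Veq i (Vnat k) &
    Veq y (Vset (nth set0 s k))].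
  move=> /(Vin_Veqr xs)/Vin_seq[k]; rewrite size_map => ks.
  by rewrite nth_map_Vset // => /Vopair_inj[ik yk]; exists k.
have inx k : (k < size s)%N -> Vin (Vopair (Vnat k) (Vset (nth set0 s k))) x.
  move=> ks; apply: Vin_Veqr (Veq_sym xs) _; apply/Vin_seq; exists k.
    by rewrite size_map.
  by rewrite nth_map_Vset //; exact: Veq_refl.
exists (Vnat (size s)); first exact: hc_nat.
split; first by apply/Vin_set2.
split.
  apply/(sat_entries he) => u /(Vin_Veqr xs)/Vin_seq[k]; rewrite size_map => ks.
  rewrite nth_map_Vset // => uk; exists (Vnat k), (Vset (nth set0 s k)); split=> //.
    exact/Vin_nat2.
  by move=> z /Vin_set[m _ zm]; apply/Vin_set; exists m.
split.
  apply/(sat_total he) => i /Vin_nat[k ks ik]; exists (Vset (nth set0 s k)).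
  apply: Vin_Veql (inx k ks); apply: Vopair_Veq; [exact: Veq_sym|exact: Veq_refl].
split.
  apply/(sat_functional he) => i y y' /xin[k [ks ik yk]] /xin[k' [k's ik' y'k']].
  have e := Vnat_inj (Veq_trans (Veq_sym ik) ik'); subst k'.
  exact: Veq_trans yk (Veq_sym y'k').
apply/(sat_increasing he) => i j y y' /xin[k [ks ik yk]] /xin[l [ls jl yl]] ij.
have kl : (k < l)%N by apply/Vin_nat2; exact: Vin_Veq ij.
rewrite (ext _ _ _ _ _ yk yl (Veq_refl b)) (ext _ _ _ _ _ yl yk (Veq_refl b)).
by apply: sinc; rewrite kl.
Qed.

(** * Homogeneity refutes definable chains *)

Lemma increasing_tuple_uniq E s : increasing_tuple E s -> uniq s.
Proof.
move=> sinc; apply/(uniqP set0) => i j; rewrite !inE => si sj e.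
have [ij|ji|//] := ltngtP i j.
  by have := sinc i j; rewrite ij sj e => -[].
by have := sinc j i; rewrite ji si e => -[].
Qed.

Lemma stationary_path {d} {K : orderType d} (Es : seq (set K)) (x : K) :
  is_omega2 K -> (forall E, E \in Es -> stationary E) ->
  exists2 s, path <%O x s & all2 (fun y (E : set K) => y \in E) s Es.
Proof.
move=> hK; elim: Es x => [|E Es IH] x sEs; first by exists [::].
have [y Ey xy] := stationary_above x hK (sEs E (mem_head _ _)).
have [E' E'Es|s ys sE] := IH y; first by apply: sEs; rewrite inE E'Es orbT.
by exists (y :: s) => /=; rewrite ?xy // mem_set.
Qed.

Lemma all2_image {T U : Type} (f : T -> U) (s : seq T) (Es : seq (set T)) :
  all2 (fun y (E : set T) => y \in E) s Es ->
  all2 (fun y (E : set U) => y \in E) (map f s) [seq f @` E | E <- Es].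
Proof.
elim: s Es => [|y s IH] [|E Es] //= /andP[/set_mem Ey sE].
by rewrite IH // andbT; apply: mem_set; exists y.
Qed.

(** The principle is applied to the set of all tuples whose entries are
   strictly E-increasing from left to right.  Two members of a stationary set, in
   the wrong order, refute the homogeneous alternative; members of
   S_0, ..., S_(k-1) picked in increasing order refute the other one. *)
Lemma HP_no_chain {d} {K : orderType d} (E : set nat -> set nat -> Prop)
    (f : K -> set nat) :
  is_omega2 K -> HP K -> set_definable E ->
  (forall a b, (a < b)%O -> E (f a) (f b) /\ ~ E (f b) (f a)) -> False.
Proof.
move=> hK hHP [p [c [hcc pE]]] fE.
have fneq a b : (a < b)%O -> f b != f a.
  by move=> /fE[Eab nEba]; apply/eqP => e; rewrite e in Eab nEba.
case: (hHP f (increasing_tuple E)).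
- by move=> s /increasing_tuple_uniq us; split.
- exists (Ftuple p), (Vopair Vomega c); split; first by apply: hc_opair => //; exact: hc_set.
  apply/seteqP; split=> [x [s sinc xs]|x [hx /(sat_tuple hx hcc pE)//]].
  have hx : hc x.
    apply: hc_Veq (Veq_sym xs) _; apply: hc_seq => i.
    have [si|si] := ltnP i (size s); first by rewrite nth_map_Vset //; exact: hc_set.
    by rewrite nth_default ?size_map //; exact: hc_empty.
  by split=> //; apply/(sat_tuple hx hcc pE); exists s.
- move=> [S sS SA]; have [|a [Sa _]] := sS setT; first by split=> // x; exists x.
  have [b Sb ab] := stationary_above a hK sS.
  have [_ nE] := fE a b ab.
  have inc : increasing_tuple E [:: f b; f a].
    apply: SA; split=> [|/=]; last by [].
    by apply: inj_tuples2; [exists b|exists a|exact: fneq].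
  by have [Eba _] := inc 0%N 1%N isT.
- move=> [Es [Es0 sEs Es_dis]].
  have [E0 E0in] : exists E0, E0 \in Es.
    by case: Es Es0 {sEs Es_dis} => // E0 Es _; exists E0; rewrite mem_head.
  have [|x [_ _]] := sEs _ E0in setT; first by split=> // x; exists x.
  have [s xs sE] := stationary_path x hK sEs.
  have s_lt i j : (i < j < size s)%N -> (nth x s i < nth x s j)%O.
    move=> /andP[ij js]; apply: (sorted_ltn_nth lt_trans) => //.
    - exact: path_sorted xs.
    - exact: ltn_trans js.
  have finc : increasing_tuple E (map f s).
    move=> i j; rewrite size_map => /andP[ij js].
    rewrite !(nth_map x) //; last exact: ltn_trans js.
    by apply: fE; apply: s_lt; rewrite ij.
  suff : set0 (map f s) by [].
  rewrite -Es_dis; split=> //; apply/andP; split; last exact: all2_image.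
  exact: increasing_tuple_uniq finc.
Qed.

(** This lets one definable relation serve both the G_delta and the F_sigma
   case. *)
Lemma set_definableN E : set_definable E -> set_definable (fun s t => ~ E s t).
Proof.
move=> [p [b [hb pE]]]; exists (FNot p), b; split=> // s t /=.
by rewrite pE.
Qed.

(** * Three definable relations *)

(** Functions enter the principle as subsets of omega; Vuncode is the
   parameter from which formulas recover them. *)
Definition graph_code (f : nat -> nat) : set nat := [set pickle (n, f n) | n in setT].

Definition uncode (k : nat) : nat * nat := odflt (0%N, 0%N) (unpickle k).

Definition Vuncode : V := Sup (fun k => Vopair (Vnat k)
  (Vopair (Vnat (uncode k).1) (Vnat (uncode k).2))).

Lemma hc_uncode : hc Vuncode.
Proof. by apply: hc_nat_family => k; do !apply: hc_opair; exact: hc_nat. Qed.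

Definition Fimage x y z := FAll (FIff (FIn 0 x.+1) (FExIn y.+1 (FInPair 0 1 z.+2))).

Lemma sat_image_code e x y z (f : nat -> nat) : henv e ->
  Veq (nth Vempty e y) (Vset (graph_code f)) -> Veq (nth Vempty e z) Vuncode ->
  sat e (Fimage x y z) <-> Veq (nth Vempty e x) (Vfun f).
Proof.
move=> he ey ez.
have key u : hc u -> sat (u :: e) (FExIn y.+1 (FInPair 0 1 z.+2)) <-> Vin u (Vfun f).
  move=> hu; have he' := henv_cons hu he; split.
    move=> /(sat_exin _ (he' y.+1))[k ky].
    move=> /(sat_inpair _ _ _ (henv_in he' ky)) kz.
    have /Vin_set[_ [n _ <-] kn] := Vin_Veqr ey ky.
    have [m km] := Vin_Veqr ez kz.
    have [/= km' um] := Vopair_inj km.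
    have mn := Vnat_inj (Veq_trans (Veq_sym km') kn); subst m.
    by apply/Vin_fun; exists n; move: um; rewrite /uncode pickleK.
  move=> [n un]; apply/(sat_exin _ (he' y.+1)); exists (Vnat (pickle (n, f n))).
    by apply: Vin_Veqr (Veq_sym ey) _; apply/Vin_set2; exists n.
  apply/(sat_inpair _ _ _ (henv_cons (hc_nat _) he')).
  apply: Vin_Veqr (Veq_sym ez) _; exists (pickle (n, f n)).
  by apply: Vopair_Veq; [exact: Veq_refl|rewrite /uncode pickleK].
split=> [/sat_all h|/Veq_ext h].
  apply/Veq_ext => u; split=> [ux|uf].
    have hu := hc_in (he x) ux; apply/(key u hu).
    by have /sat_iff[/(_ ux)] := h u hu.
  have hu := hc_in (hc_fun f) uf.
  by have /sat_iff[_] := h u hu; apply; exact/(key u hu).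
apply/sat_all => u hu; apply/sat_iff; rewrite (key u hu); exact: h.
Qed.

(** The formula says that the functions recovered from the two codes form a
   pair that satisfies the formula defining R; its parameter is paired with
   the table. *)
Lemma definable_rel_of (R : set V) : definable R -> exists2 E, set_definable E &
  forall f g, E (graph_code f) (graph_code g) <-> rel_of R f g.
Proof.
move=> [p [a [ha Rp]]].
pose q := FEx (FEx (FAnd (FOpair 4 1 0) (FEx (FEx (FEx (FAnd (Fimage 2 5 4)
  (FAnd (Fimage 1 6 4) (FAnd (FOpair 0 2 1)
    (frename (fun i => nth (i + 8) [:: 0; 3] i) p))))))))).
pose b := Vopair Vuncode a.
have hb : hc b by apply: hc_opair => //; exact: hc_uncode.
exists (fun s t => sat [:: Vset s; Vset t; b] q); first by exists q, b.
move=> f g.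
have he0 u c : hc u -> hc c -> henv [:: c; u; Vset (graph_code f); Vset (graph_code g); b].
  by move=> hu hc'; do !apply: henv_cons => //; try exact: hc_set; exact: henv_nil.
have ren z G F c u : Veq z (Vopair (Vfun f) (Vfun g)) -> Veq c a ->
    sat [:: z; G; F; c; u; Vset (graph_code f); Vset (graph_code g); b]
      (frename (fun i => nth (i + 8) [:: 0; 3] i) p) <->
    sat [:: Vopair (Vfun f) (Vfun g); a] p.
  move=> zfg ca; apply: sat_rename => -[|[|k]] //=.
  by rewrite addnC !nth_nil; exact: Veq_refl.
have hfg : hc (Vopair (Vfun f) (Vfun g)) by apply: hc_opair; exact: hc_fun.
have -> : rel_of R f g <-> sat [:: Vopair (Vfun f) (Vfun g); a] p.
  by rewrite /rel_of Rp; split=> [/asboolP[]//|h]; apply/asboolP.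
split=> [[u hu [c hc' [buc [F hF [G hG [z hz [FP [GP [zP pz]]]]]]]]]|pfg].
  have [ub ca] := Vopair_inj ((sat_opair 4 1 0 (he0 u c hu hc')).1 buc).
  have he := henv_cons hz (henv_cons hG (henv_cons hF (he0 u c hu hc'))).
  move: FP GP zP pz.
  move=> /(@sat_image_code _ 2 5 4 f he (Veq_refl _) (Veq_sym ub)) Ff.
  move=> /(@sat_image_code _ 1 6 4 g he (Veq_refl _) (Veq_sym ub)) Gg.
  move=> /(sat_opair 0 2 1 he) zFG /ren; apply; last exact: Veq_sym.
  by apply: Veq_trans zFG _; exact: Vopair_Veq.
have hu := hc_uncode.
exists Vuncode => //; exists a => //; split.
  by apply/(sat_opair 4 1 0 (he0 _ _ hu ha)); exact: Veq_refl.
exists (Vfun f); first exact: hc_fun.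
exists (Vfun g); first exact: hc_fun.
exists (Vopair (Vfun f) (Vfun g)) => //.
have he := henv_cons hfg (henv_cons (hc_fun g) (henv_cons (hc_fun f) (he0 _ _ hu ha))).
split.
  apply/(@sat_image_code _ 2 5 4 f he (Veq_refl _) (Veq_refl _)).
  exact: Veq_refl.
split.
  apply/(@sat_image_code _ 1 6 4 g he (Veq_refl _) (Veq_refl _)).
  exact: Veq_refl.
split; first by apply/(sat_opair 0 2 1 he); exact: Veq_refl.
by apply/ren => //; exact: Veq_refl.
Qed.

Definition pair_code (Z : set nat) (C : set (nat * nat)) : set nat :=
  [set k.*2 | k in Z] `|` [set (pickle p).*2.+1 | p in C].

(** With the even part of s coding a set of intervals k and the odd part of t
   a set of pairs (n, k), this is the form of membership in a G_delta set. *)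
Definition meets_all (s t : set nat) :=
  forall n : nat, exists k : nat, s k.*2 /\ t (pickle (n, k)).*2.+1.

Lemma pair_code_even Z C k : pair_code Z C k.*2 <-> Z k.
Proof.
split=> [[[j Zj /double_inj <-]//|[p _ e]]|Zk]; last by left; exists k.
by have := odd_double k; rewrite -e /= odd_double.
Qed.

Lemma pair_code_odd Z C p : pair_code Z C (pickle p).*2.+1 <-> C p.
Proof.
split=> [[[j _ e]|[q Cq [/double_inj/(pcan_inj pickleK)<-]]]|Cp] //.
  by have := odd_double j; rewrite e /= odd_double.
by right; exists p.
Qed.

(** The parameter is the set, indexed by n, of the sets of all pairs of codes
   of k and (n, k). *)
Lemma set_definable_meets_all : set_definable meets_all.
Proof.
pose r (n : nat) := Sup (fun k : nat => Vopair (Vnat k.*2) (Vnat (pickle (n, k)).*2.+1)).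
pose b := Sup r.
have hr n : hc (r n).
  by apply: hc_nat_family => k; apply: hc_opair; exact: hc_nat.
have hb : hc b by exact: hc_nat_family.
exists (FAllIn 2 (FExIn 0 (FExIn 2 (FExIn 4 (FOpair 2 1 0))))), b; split=> // s t.
have he : henv [:: Vset s; Vset t; b].
  by do !apply: henv_cons => //; try exact: hc_set; exact: henv_nil.
split=> [/(sat_allin _ (he 2)) h n|st].
  have rb : Vin (r n) b by exists n; exact: Veq_refl.
  have he1 := henv_cons (hr n) he.
  have /(sat_exin _ (he1 0))[u ur /(sat_exin _ (henv_in (i := 0) he1 ur 2))] := h _ rb.
  have he2 := henv_in (i := 0) he1 ur.
  move=> [c cs]; have he3 := henv_in (i := 2) he2 cs.
  move=> /(sat_exin _ (he3 4))[e et].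
  move=> /(sat_opair 2 1 0 (henv_in (i := 4) he3 et)) uce.
  have [k uk] := ur; have [kc ke] := Vopair_inj (Veq_trans (Veq_sym uk) uce).
  exists k; split; apply/Vin_set2.
    exact: Vin_Veql (Veq_sym kc) cs.
  exact: Vin_Veql (Veq_sym ke) et.
apply/(sat_allin _ (he 2)) => w wb; have [n wn] := wb; have [k [sk tk]] := st n.
have he1 := henv_in (i := 2) he wb.
apply/(sat_exin _ (he1 0)).
exists (Vopair (Vnat k.*2) (Vnat (pickle (n, k)).*2.+1)) => [|].
  by apply: (Vin_Veqr (Veq_sym wn)); exists k; exact: Veq_refl.
have he2 : henv [:: Vopair (Vnat k.*2) (Vnat (pickle (n, k)).*2.+1); w;
    Vset s; Vset t; b].
  by apply: henv_cons => //; apply: hc_opair; exact: hc_nat.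
apply/(sat_exin _ (he2 2)); exists (Vnat k.*2); first exact/Vin_set2.
have he3 := henv_cons (hc_nat k.*2) he2.
apply/(sat_exin _ (he3 4)); exists (Vnat (pickle (n, k)).*2.+1); first exact/Vin_set2.
have he4 := henv_cons (hc_nat (pickle (n, k)).*2.+1) he3.
by apply/(sat_opair 2 1 0 he4); exact: Veq_refl.
Qed.

Lemma Vin_opair_fun n y (f : nat -> nat) : Vin (Vopair (Vnat n) y) (Vfun f) <->
  Veq y (Vnat (f n)).
Proof.
split=> [[m /Vopair_inj[/Vnat_inj -> //]]|yn]; exists n.
by apply: Vopair_Veq => //; exact: Veq_refl.
Qed.

(** At arguments above variable 1, the function 3 takes values at most those of the
   function 2. *)
Definition Fdominated := FAll (FAll (FAll (FImp (FInPair 2 1 6)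
  (FImp (FInPair 2 0 5) (FImp (FIn 4 2) (FOr (FIn 1 0) (FEq 1 0))))))).

Lemma definable_ev_dom : exists R : set V,
  [/\ definable R, forall z, R z -> exists x y, Veq z (Vopair x y) &
      forall f g, rel_of R f g <-> ev_dom f g].
Proof.
pose q := FEx (FEx (FAnd (FOpair 2 1 0) (FEx (FEx (FAnd (FInPair 1 0 3) Fdominated))))).
exists [set x | hc x /\ sat [:: x; Vempty] q]; split.
- by exists q, Vempty; split=> //; exact: hc_empty.
- move=> z [hz [x hx [y hy [zxy _]]]]; exists x, y.
  apply: (sat_opair 2 1 0 _).1 zxy.
  by do !apply: henv_cons => //; try exact: hc_empty; exact: henv_nil.
move=> f g.
have hfg : hc (Vopair (Vfun f) (Vfun g)) by apply: hc_opair; exact: hc_fun.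
have he0 x y : hc x -> hc y -> henv [:: y; x; Vopair (Vfun f) (Vfun g); Vempty].
  by move=> hx hy; do !apply: henv_cons => //; try exact: hc_empty; exact: henv_nil.
split=> [/asboolP[_ [F hF [G hG [/(sat_opair 2 1 0 (he0 F G hF hG)) zFG]]]]|/ev_domP[N fg]].
  have [fF gG] := Vopair_inj zFG.
  move=> [m hm [k hk [mkF h]]].
  have hmk := henv_cons hk (henv_cons hm (he0 F G hF hG)).
  have mk := (sat_inpair 1 0 3 hmk).1 mkF.
  have [M /Vopair_inj[mM _]] := Vin_Veqr (Veq_sym fF) mk.
  apply/ev_domP; exists M.+1 => n Mn.
  have /sat_all : sat [:: k; m; G; F; Vopair (Vfun f) (Vfun g); Vempty] Fdominated := h.
  move=> /(_ _ (hc_nat n))/sat_all/(_ _ (hc_nat (f n)))/sat_all/(_ _ (hc_nat (g n))).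
  have he := henv_cons (hc_nat (g n)) (henv_cons (hc_nat (f n)) (henv_cons (hc_nat n)
    (henv_cons hk (henv_cons hm (he0 F G hF hG))))).
  have nF : Vin (Vopair (Vnat n) (Vnat (f n))) F.
    by apply: Vin_Veqr fF _; apply/Vin_opair_fun; exact: Veq_refl.
  have nG : Vin (Vopair (Vnat n) (Vnat (g n))) G.
    by apply: Vin_Veqr gG _; apply/Vin_opair_fun; exact: Veq_refl.
  have mn : Vin m (Vnat n) by apply: Vin_Veql (Veq_sym mM) _; exact/Vin_nat2.
  move=> /sat_imp/(_ ((sat_inpair 2 1 6 he).2 nF))/sat_imp.
  move=> /(_ ((sat_inpair 2 0 5 he).2 nG))/sat_imp/(_ mn)/sat_or[/Vin_nat2|/Vnat_inj ->//].
  exact: ltnW.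
apply/asboolP; split=> //; exists (Vfun f); first exact: hc_fun.
exists (Vfun g); first exact: hc_fun.
have he1 := he0 _ _ (hc_fun f) (hc_fun g).
split; first by apply/(sat_opair 2 1 0 he1); exact: Veq_refl.
exists (Vnat N); first exact: hc_nat.
exists (Vnat (f N)); first exact: hc_nat.
have he2 := henv_cons (hc_nat (f N)) (henv_cons (hc_nat N) he1).
split.
  by apply/(sat_inpair 1 0 3 he2); apply/Vin_opair_fun; exact: Veq_refl.
apply/sat_all => n hn; apply/sat_all => i hi; apply/sat_all => j hj.
have he3 := henv_cons hj (henv_cons hi (henv_cons hn he2)).
apply/sat_imp => /(sat_inpair 2 1 6 he3)[n' /Vopair_inj[nn' ifn]].
apply/sat_imp => /(sat_inpair 2 0 5 he3) njg.
have {njg} /Vin_opair_fun jgn : Vin (Vopair (Vnat n') j) (Vfun g).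
  by apply: Vin_Veql njg; apply: Vopair_Veq => //; exact: Veq_refl.
apply/sat_imp => Nn; have {Nn}Nn' : (N < n')%N by apply/Vin_nat2; exact: Vin_Veqr Nn.
apply/sat_or; have := fg n' (ltnW Nn').
rewrite leq_eqVlt => /orP[/eqP e|lt]; [right|left].
  by apply: Veq_trans ifn _; rewrite e; exact: Veq_sym.
by apply: (Vin_Veq (Veq_sym ifn) (Veq_sym jgn)); exact/Vin_nat2.
Qed.

(** * Uniformity and covering of sigma-ideals on the line *)

Lemma countable_cover {T : pointedType} (B : set T) : countable B ->
  exists e : nat -> T, (B `<=` range e) /\ (B !=set0 -> forall n, B (e n)).
Proof.
move=> cB; have [->|/set0P B0] := eqVneq B set0.
  by exists (fun=> point); split=> // -[].
have [b Bb] := B0.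
have [|c _ cinj] := card_le_injP cB; first by exists 0%N.
exists (fun n => xget b [set x | B x /\ c x = n]); split=> [x Bx|_ n].
  exists (c x) => //; case: xgetP => [y _ [By cy]|/(_ x)]; first exact: cinj.
  by case.
by case: xgetP => [y _ []|].
Qed.

Section sigma_ideal.
Variables (R : realType) (J : set (set R)).
Hypothesis Isub : forall A B, A `<=` B -> J B -> J A.
Hypothesis Iunion : forall F : nat -> set R, (forall n, J (F n)) -> J (\bigcup_n F n).
Hypothesis Iset1 : forall x, J [set x].
Hypothesis InsetT : ~ J setT.

Lemma countable_in_ideal (B : set R) : countable B -> J B.
Proof.
move=> /countable_cover[e [Be _]]; apply: Isub (Iunion (fun n => Iset1 (e n))).
by move=> x /Be[n _ <-]; exists n.
Qed.

Definition covers_in (G : set (set R)) := G `<=` J /\ \bigcup_(B in G) B = setT.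

Lemma covers_in_uncountable G : covers_in G -> ~ countable G.
Proof.
move=> [GI GT] /countable_cover[e [Ge eG]]; apply: InsetT.
have G0 : G !=set0.
  have : [set: R] 0%R by []; rewrite -GT => -[B GB _]; by exists B.
apply: Isub (Iunion (fun n => GI _ (eG G0 n))).
by rewrite -GT => x [B /Ge[n _ <-] Bx]; exists n.
Qed.

Definition rational_interval (k : nat) : set R :=
  let p := odflt (0%R, 0%R) (@unpickle (rat * rat)%type k) in
  [set` `](ratr p.1 : R), (ratr p.2 : R)[%R].

(** Rational points on both sides of x, within a ball included in U. *)
Lemma rational_interval_base (U : set R) (x : R) : open U -> U x ->
  exists k, rational_interval k x /\ rational_interval k `<=` U.
Proof.
rewrite openE => oU Ux; have /nbhs_ballP[e /= e0 eU] := oU x Ux.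
have [|p] := @rat_in_itvoo R (x - e)%R x; first by rewrite ltrBlDr ltrDl.
rewrite in_itv /= => /andP[ep px].
have [|q] := @rat_in_itvoo R x (x + e)%R; first by rewrite ltrDl.
rewrite in_itv /= => /andP[xq qe].
exists (pickle (p, q)); rewrite /rational_interval pickleK /=; split.
  by rewrite /= in_itv /= px xq.
move=> y /=; rewrite in_itv /= => /andP[py yq]; apply: eU.
rewrite /ball /= ltr_distlC; apply/andP; split.
  exact: lt_trans ep py.
exact: lt_trans yq qe.
Qed.

(** The even part locates x among the rational intervals; the odd part lists
   the rational intervals included in each open set, which determines this
   set. *)
Definition position_code (x : R) (U : nat -> set R) : set nat :=
  pair_code [set k | rational_interval k x]
    [set p | rational_interval p.2 `<=` U p.1].

Lemma position_codeP x U y W : (forall n, open (W n)) ->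
  meets_all (position_code x U) (position_code y W) <-> (\bigcap_n W n) x.
Proof.
move=> oW; split=> [h n _|h n].
  by have [k [/pair_code_even xk /pair_code_odd kW]] := h n; exact: kW.
have [k [xk kW]] := rational_interval_base (oW n) (h n Logic.I).
by exists k; split; [exact/pair_code_even|exact/pair_code_odd].
Qed.

(** The G_delta set given by U if b holds, and an F_sigma set otherwise. *)
Definition hull (b : bool) (U : nat -> set R) : set R :=
  if b then \bigcap_n U n else ~` \bigcap_n U n.

Hypothesis Jhull : exists b, forall M, J M ->
  exists U, [/\ forall n, open (U n), M `<=` hull b U & J (hull b U)].

(** If both cardinals exceeded aleph_1, one could choose reals x_a and
   sets M_a in J, a < omega_2, with x_b in M_a and x_c outside M_a for
   all b < a < c.  The M_a may be taken to be hulls, so that membership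
   of a real in them is definable from codes. *)
Lemma min_non_cov_aleph1 {T : Type} (A : set T) {d} (K : orderType d) :
  is_aleph1 A -> is_omega2 K -> HP K -> is_min_non_cov J A.
Proof.
move=> hA hK hHP.
have [N Nmin] := card_min_exists (ex_intro [set B | ~ J B] setT InsetT).
have [|F Fmin] := @card_min_exists _ [set G | covers_in G].
  exists [set [set x] | x in setT]; split; first by move=> _ [x _ <-].
  by apply/seteqP; split=> // x _; exists [set x] => //; exists x.
have AN : A #<= N.
  by apply: aleph1_leP => // /countable_in_ideal; have [] := Nmin.
have AF : A #<= F.
  by apply: aleph1_leP => //; apply: covers_in_uncountable; have [] := Fmin.
exists N, F; split=> //.
suff [NA|FA] : N #<= A \/ F #<= A.
- left; split; first exact: card_le_trans NA AF.
  exact: Cantor_Bernstein.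
- right; split; first exact: card_le_trans FA AN.
  exact: Cantor_Bernstein.
apply: contrapT => /not_orP[nNA nFA].
have [b hullP] := Jhull.
have [||f [g [gP fg gf]]] := omega2_chain (K := K) (PX := setT)
    (PY := [set U | (forall n, open (U n)) /\ J (hull b U)])
    (E := fun x U => hull b U x) hA hK.
- move=> Z _ ZA; have JZ : J Z.
    apply: contrapT => nJZ; apply: nNA; apply: card_le_trans ZA.
    by have [_] := Nmin; apply.
  by have [U [oU ZU JU]] := hullP Z JZ; exists U.
- move=> S SP SA; apply: contrapT => nx; apply: nFA.
  apply: card_le_trans (card_le_trans (card_image_le (hull b) S) SA).
  have [_] := Fmin; apply; split=> [_ [U /SP[_ JU] <-]//|].
  apply/seteqP; split=> // x _; apply: contrapT => nxS; apply: nx; exists x => //.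
  by move=> U SU xU; apply: nxS; exists (hull b U) => //; exists U.
pose s a := position_code (f a) (g a).
have sP a c : meets_all (s a) (s c) <-> (\bigcap_n g c n) (f a).
  by apply: position_codeP; have [_ []] := gP c.
case: b hullP gP fg gf => hullP gP fg gf.
  apply: (HP_no_chain hK hHP set_definable_meets_all (f := s)) => a c ac.
  by rewrite !sP; split; [exact: fg|exact: gf].
apply: (HP_no_chain hK hHP (set_definableN set_definable_meets_all) (f := s)).
move=> a c ac; rewrite !sP; split; [exact: fg|exact: gf].
Qed.
End sigma_ideal.

(** * Meager and null sets *)

Lemma nowhere_dense_sub {T : topologicalType} (A B : set T) :
  A `<=` B -> nowhere_dense B -> nowhere_dense A.
Proof.
move=> AB nB; apply/seteqP; split=> // x /(interiorS (closureS AB)).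
by rewrite nB.
Qed.

Lemma meager_sub {T : topologicalType} (A B : set T) :
  A `<=` B -> meager B -> meager A.
Proof.
move=> AB [F nF BF]; exists (fun n => F n `&` A) => [n|].
  exact: nowhere_dense_sub (@subIsetl _ _ _) (nF n).
rewrite -setI_bigcupl -BF; apply/esym/setIidPr; exact: AB.
Qed.

Lemma meager_bigcup {T : topologicalType} (F : nat -> set T) :
  (forall n, meager (F n)) -> meager (\bigcup_n F n).
Proof.
move=> mF; have /choice[G GP] : forall n, exists G : nat -> set T,
    (forall m, nowhere_dense (G m)) /\ F n = \bigcup_m G m.
  by move=> n; have [G nG FG] := mF n; exists G.
exists (fun k => if unpickle k is Some p then G p.1 p.2 else set0) => [k|].
  case: unpickle => [p|]; first by have [] := GP p.1.
  by rewrite /nowhere_dense closure0 interior0.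
apply/seteqP; split=> [x [n _]|x [k _]].
  have [_ ->] := GP n; move=> [m _ Gx]; exists (pickle (n, m)) => //.
  by rewrite pickleK.
case: unpickle => // p Gx; exists p.1 => //.
by have [_ ->] := GP p.1; exists p.2.
Qed.

Lemma meager_set1 {R : realType} (x : R) : meager [set x].
Proof.
exists (fun=> [set x]) => [_|]; last by rewrite bigcup_const.
rewrite /nowhere_dense -(closure_id _).1; last first.
  exact/accessible_closed_set1/hausdorff_accessible/Rhausdorff.
apply/seteqP; split=> // y yx.
have ne : (interior [set x] : set R^o) !=set0 by exists y.
have [z [/interior_subset zx]] := dense_set1C x ne (@open_interior R _).
by apply.
Qed.

(** The Baire category theorem. *)
Lemma nonmeager_setT {R : realType} : ~ meager [set: R].
Proof.
move=> [F nF FT].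
have dF : dense (\bigcap_n ~` closure (F n)).
  apply: (@Baire R R^o) => n; split; first exact/closed_openC/closed_closure.
  move=> O [y Oy] oO; apply: contrapT => nO.
  have : interior (closure (F n)) y.
    rewrite /interior /=; apply: filterS (open_nbhs_nbhs (conj oO Oy)) => z Oz.
    by apply: contrapT => nz; apply: nO; exists z.
  by rewrite nF.
have T0 : [set: R] !=set0 by exists 0%R.
have [x [_ xF]] := dF _ T0 openT.
have : [set: R] x by []; rewrite FT => -[n _ Fx].
by apply: (xF n Logic.I); exact: subset_closure.
Qed.

(** The union of the closures of the nowhere dense sets. *)
Lemma meager_hull {R : realType} (M : set R) : meager M ->
  exists U : nat -> set R,
    [/\ forall n, open (U n), M `<=` hull false U & meager (hull false U)].
Proof.
move=> [F nF ->]; exists (fun n => ~` closure (F n)).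
have -> : hull false (fun n => ~` closure (F n)) = \bigcup_n closure (F n).
  by rewrite /hull setC_bigcap; apply: eq_bigcupr => n _; rewrite setCK.
split=> [n||]; first exact/closed_openC/closed_closure.
  by apply: subset_bigcup => n _; exact: subset_closure.
exists (fun n => closure (F n)) => // n.
rewrite /nowhere_dense -((closure_id _).1 (@closed_closure _ (F n))); exact: nF.
Qed.

(** Outer regularity of Lebesgue measure. *)
Lemma null_hull {R : realType} (M : set R) : null M ->
  exists U : nat -> set R,
    [/\ forall n, open (U n), M `<=` hull true U & null (hull true U)].
Proof.
move=> /negligible_outer_measure M0.
have [U [oU MU U0]] := outer_measure_Gdelta M.
exists U; split=> //; apply/negligibleP; last exact: etrans U0 M0.
by apply: bigcapT_measurable => n; exact: measurable_realfun.open_measurable.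
Qed.

Lemma nonnull_setT {R : realType} : ~ null [set: R].
Proof.
move=> /negligibleP => /(_ measurableT) T0.
have := @lebesgue_measure_itv R `]-oo, +oo[%R; rewrite set_itvNyy /= => Tinf.
by have := etrans (esym T0) Tinf.
Qed.

Lemma null_set1 {R : realType} (x : R) : null [set x].
Proof. by apply/negligibleP; [exact: measurable_set1|exact: lebesgue_measure_set1]. Qed.

(** * The cardinal invariants *)

Lemma card_le_supremum {T U : Type} {A : set T} (F : set (set U)) (X : set U) :
  is_aleph1 A -> (forall Y, F Y -> Y #<= A) -> F X -> ~ countable X -> card_sup F A.
Proof.
move=> hA FA FX nX; split=> // W L FL.
exact: card_le_trans (aleph1_leP hA nX) (FL X FX).
Qed.

(** A scale shows that S^h has an uncountable member, and a member of S^h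
   above aleph_1 would yield a chain. *)
Lemma Cs_bh {d} {K : orderType d} {T : Type} (A : set T) :
  is_aleph1 A -> is_omega2 K -> Cs K \/ Cs_hat K -> is_bh A.
Proof.
move=> hA hK hC.
have [|X hX _] := @exists_scale (fun f g => `[< ev_dom f g >]).
  by move=> f g; split=> /asboolP.
apply: (card_le_supremum hA _ hX (Sh_uncountable hX)) => Y hY.
apply: contrapT => YA; have [f [g [fg gf]]] := Sh_chain hA hK hY YA.
exact: Cs_no_chain hK hC fg gf.
Qed.

(** A set that is well-ordered with cofinality above aleph_1 contains an
   increasing sequence of length omega_2, as no initial segment of the
   construction is cofinal. *)
Lemma HP_do {d} {K : orderType d} {T : Type} (A : set T) :
  is_aleph1 A -> is_omega2 K -> HP K -> is_do A.
Proof.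
move=> hA hK hHP.
have [R0 [dR0 pR0 R0E]] := definable_ev_dom.
have [X hX woX] := exists_scale R0E.
have DOX : DO X.
  exists X, R0; split=> //; split; last first.
    by move=> C; apply: Sh_cofinal hX => f g /R0E.
  by split=> // x Xx; exists x => //; apply/R0E; exact: ev_dom_refl.
apply: (card_le_supremum hA _ DOX (Sh_uncountable hX)) => C.
move=> [Y [R [dR _ woY [[CY _] Cmin]]]]; apply: contrapT => CA.
have Rtot x y : Y x -> Y y -> rel_of R x y || rel_of R y x.
  by move=> Yx Yy; apply: (wochoice.wo_chainW woY); exact: mem_set.
have Ranti x y : Y x -> Y y -> rel_of R x y -> rel_of R y x -> x = y.
  move=> Yx Yy xy yx; apply: (wochoice.wo_chain_antisymmetric woY).
  - exact: mem_set.
  - exact: mem_set.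
  - by rewrite xy.
have [wf _ _] := hK.
have [|f [fY fR]] := @wf_pairwise_choice K _ (fun=> 0%N) _ (fun _ t => Y t)
    (fun s t => rel_of R s t /\ s <> t) wf.
  move=> a g gY; pose S := [set g b | b in [set b | (b < a)%O]].
  have SA : S #<= A.
    by apply: card_le_trans (card_image_le _ _) _; exact: omega2_segment.
  have SY : S `<=` Y by move=> _ [b ba <-]; exact: gY.
  have [x [Yx xS]] : exists x, Y x /\ forall s, S s -> ~ rel_of R x s.
    apply: contrapT => nx; apply: CA; apply: card_le_trans SA; apply: Cmin.
    split=> // x Yx; apply: contrapT => ns; apply: nx; exists x; split=> // s Ss xs.
    by apply: ns; exists s.
  exists x; split=> // b ba; have Sb : S (g b) by exists b.
  have nxb := xS _ Sb; split.
    by have /orP[//|/nxb] := Rtot _ _ (SY _ Sb) Yx.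
  by move=> e; apply: nxb; have := Rtot _ _ Yx Yx; rewrite orbb e.
have [E dE EP] := definable_rel_of dR.
apply: (HP_no_chain hK hHP dE (f := fun a => graph_code (f a))) => a b ab.
have [Rab neab] := fR a b ab; rewrite !EP; split=> // Rba.
exact: neab (Ranti _ _ (fY a) (fY b) Rab Rba).
Qed.

Theorem corollary3p9 (R : realType) (T : Type) (aleph1 : set T)
    (h1 : is_aleph1 aleph1) (d : Order.disp_t) (omega2 : orderType d)
    (h2 : is_omega2 omega2) :
  (Cs omega2 \/ Cs_hat omega2 -> is_bh aleph1) /\
  (HP omega2 ->
     [/\ is_do aleph1,
         is_min_non_cov (@meager R) aleph1 &
         is_min_non_cov (@null R) aleph1]).
Proof.
split=> [hC|hHP]; first exact: Cs_bh hC.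
split; first exact: HP_do hHP.
  apply: (@min_non_cov_aleph1 R meager meager_sub meager_bigcup meager_set1 nonmeager_setT _
    T aleph1 d omega2) => //.
  by exists false => M /meager_hull.
apply: (@min_non_cov_aleph1 R (@null R) _ _ null_set1 nonnull_setT _
  T aleph1 d omega2) => //.
- by move=> A B AB; exact: negligibleS.
- by move=> F; exact: negligible_bigcup.
- by exists true => M /null_hull.
Qed.
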